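(* Fix real numbers $x>0$, $y>0$, $\beta<0$ with $xy<1$. For each $N$ let $\lambda=(\lambda_1,\ldots,\lambda_N)$ be the Grothendieck random partition with homogeneous parameters $x,y,\beta$. Then for any fixed $\tau\in(0,1]$ we have the convergence in probability $$\frac{\lambda_{\lfloor\tau N\rfloor}}{N}\to\mathfrak{L}(\tau)+\tau-1,\qquad N\to+\infty,$$ where $\mathfrak{L}$ is the continuous function on $[0,1]$ determined by $\mathfrak{H}(\mathfrak{L}(\tau),\tau)=\tau$ for all $\tau\in[0,1]$, with $\mathfrak{H}$ the limit shape of the height function of the associated Schur process.
   Context: Partitions have at most $N$ parts. Grothendieck measure with homogeneous parameters: $$\mathrm{Prob}(\lambda)=\frac{(1-xy)^{N^2}}{(1-x\beta)^{N(N-1)}}\,G_\lambda(x,\ldots,x)\,\overline G_\lambda(y,\ldots,y),$$ where (as polynomials, evaluated at coinciding arguments) $$G_\lambda(x_1,\ldots,x_N)=\frac{\det\bigl[x_i^{\lambda_j+N-j}(1-\beta x_i)^{j-1}\bigr]_{i,j=1}^N}{\prod_{i<j}(x_i-x_j)},\qquad \overline G_\lambda(y_1,\ldots,y_N)=\frac{\det\bigl[y_i^{\lambda_j+N-j}(1-\beta y_i^{-1})^{N-j}\bigr]_{i,j=1}^N}{\prod_{i<j}(y_i-y_j)}.$$ Associated Schur process: the probability measure on $N$-tuples of partitions $(\mu^1,\ldots,\mu^N)$, each with at most $N$ parts, with weights proportional to $$s_{\mu^1}(\underbrace{x,\ldots,x}_N)\Bigl(\prod_{m=1}^{N-1}(-\beta)^{|\mu^m|-|\mu^{m+1}|}\prod_{j=1}^N\mathbf{1}_{\mu^m_j-\mu^{m+1}_j\in\{0,1\}}\Bigr)s_{\mu^N}(\underbrace{y,\ldots,y}_N),$$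 with $s_\mu$ Schur polynomials. Set $x^t_j=\mu^t_j+N-j$ and define the height function $H_N(a,t)=\#\{j:x^t_j\ge a\}$ for $a\in\mathbb{Z}_{\ge0}$, $t\in\{1,\ldots,N\}$. Limit shape $\mathfrak{H}$: there is a continuous, piecewise differentiable function $\mathfrak{H}(\xi,\tau)$ on $[0,\infty)\times[0,1]$, weakly decreasing in both variables, such that $N^{-1}H_N(\lfloor\xi N\rfloor,\lfloor\tau N\rfloor)\to\mathfrak{H}(\xi,\tau)$ in probability as $N\to\infty$ (for $\tau>0$; the values at $\tau=0$ are determined by continuity). The function $\mathfrak{L}\colon[0,1]\to[0,\infty)$ is the unique continuous function with $\mathfrak{H}(\mathfrak{L}(\tau),\tau)=\tau$ for all $\tau\in[0,1]$. *)

(* Defs.v *)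
From HB Require Import structures.
From mathcomp Require Import all_boot all_order all_algebra.
From mathcomp Require Import all_classical all_reals all_analysis.
(* Notations are not imported: they clash with those of the analysis
   library. *)
From mathcomp Require Import(canonicals, coercions) mpoly.

Set Implicit Arguments.
Unset Strict Implicit.
Unset Printing Implicit Defensive.

Import Order.TTheory GRing.Theory Num.Theory.
Import numFieldNormedType.Exports.

Local Open Scope classical_set_scope.
Local Open Scope ring_scope.

(* Partitions with at most N parts, padded with zeros to length N. *)
Definition npartition (N : nat) := {p : N.-tuple nat | sorted geq p}.

(* Parts are numbered from 1; only the values at 1 <= j <= N are meaningful. *)
Definition part (N : nat) (p : npartition N) (j : nat) : nat :=
  nth 0%N (sval p) j.-1.

Definition psize (N : nat) (p : npartition N) : nat :=
  (\sum_(1 <= j < N.+1) part p j)%N.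

Lemma sorted_nseq0 (N : nat) : sorted geq (nseq_tuple N 0%N).
Proof. by case: N => //= N; elim: N => //= N ->. Qed.

Definition empty_part (N : nat) : npartition N :=
  exist _ (nseq_tuple N 0%N) (sorted_nseq0 N).

Section AlternantPolynomials.
Variables (R : realType) (N : nat).

Local Notation mpolyR := (mpoly.mpoly N R).

Definition mvar (i : 'I_N) : mpolyR := mpoly.mpolyX R (mpoly.mnm1 i).

Definition vandermonde : mpolyR :=
  \prod_(i < N) \prod_(j < N | (i < j)%N) (mvar i - mvar j).

(* det A / \prod_(i < j) (x_i - x_j) as a polynomial: the ring of polynomials
   is a domain and the Vandermonde product is nonzero, so there is at most one
   such quotient.  The default 0 is never used for the alternants below, which
   are all divisible by the Vandermonde product. *)
Definition alternant_quotient (A : 'M[mpolyR]_N) : mpolyR :=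
  xget 0 [set g | g * vandermonde = \det A].

(* Matrix indices in 'I_N start at 0: the column j below is the column
   number j + 1 of the usual formulas. *)
Definition schur_poly (mu : npartition N) : mpolyR :=
  alternant_quotient
    (\matrix_(i < N, j < N) mvar i ^+ (part mu j.+1 + (N - j.+1))).

Definition groth_poly (beta : R) (lam : npartition N) : mpolyR :=
  alternant_quotient
    (\matrix_(i < N, j < N) (mvar i ^+ (part lam j.+1 + (N - j.+1))
                             * (1 - beta *: mvar i) ^+ j)).

(* The entry y^(lam_j + N - j) (1 - beta / y)^(N - j) is written as the
   polynomial y^(lam_j) (y - beta)^(N - j). *)
Definition dual_groth_poly (beta : R) (lam : npartition N) : mpolyR :=
  alternant_quotient
    (\matrix_(i < N, j < N) (mvar i ^+ part lam j.+1
                             * (mvar i - beta *: 1) ^+ (N - j.+1))).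

(* Evaluation with all N variables equal to z. *)
Definition eval_at (z : R) (g : mpolyR) : R := mpoly.meval (fun=> z) g.

Definition groth_prob (x y beta : R) (lam : npartition N) : R :=
  (1 - x * y) ^+ (N ^ 2) / (1 - x * beta) ^+ (N * N.-1)
  * eval_at x (groth_poly beta lam) * eval_at y (dual_groth_poly beta lam).

(* N-tuples (mu^1, ..., mu^N); the superscript is numbered from 1. *)
Definition level (mu : N.-tuple (npartition N)) (t : nat) : npartition N :=
  nth (empty_part N) mu t.-1.

Definition vertical_strip (mu nu : npartition N) : bool :=
  [forall j : 'I_N, (part mu j.+1 == part nu j.+1)
                    || (part mu j.+1 == (part nu j.+1).+1)].

Definition schur_process_weight (x y beta : R)
    (mu : N.-tuple (npartition N)) : R :=
  eval_at x (schur_poly (level mu 1))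
  * (\prod_(1 <= m < N)
       ((- beta) ^ ((psize (level mu m))%:Z - (psize (level mu m.+1))%:Z)
        * (vertical_strip (level mu m) (level mu m.+1))%:R))
  * eval_at y (schur_poly (level mu N)).

Definition height (mu : N.-tuple (npartition N)) (a t : nat) : nat :=
  #|[set j : 'I_N | (a <= part (level mu t) j.+1 + (N - j.+1))%N]%SET|.

End AlternantPolynomials.

Definition is_grothendieck (R : realType) (x y beta : R) (N : nat)
    (d : measure_display) (T : measurableType d) (P : probability T R)
    (lam : T -> npartition N) : Prop :=
  forall p : npartition N,
    measurable (lam @^-1` [set p]) /\
    P (lam @^-1` [set p]) = (groth_prob x y beta p)%:E.

Definition is_schur_process (R : realType) (x y beta : R) (N : nat)
    (d : measure_display) (T : measurableType d) (P : probability T R)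
    (mu : T -> N.-tuple (npartition N)) : Prop :=
  exists c : R, forall m : N.-tuple (npartition N),
    measurable (mu @^-1` [set m]) /\
    P (mu @^-1` [set m]) = (c * schur_process_weight x y beta m)%:E.

(* The N-th variable may live on its own probability space. *)
Definition cvg_in_probability (R : realType) (d : nat -> measure_display)
    (T : forall N, measurableType (d N)) (P : forall N, probability (T N) R)
    (X : forall N, T N -> R) (c : R) : Prop :=
  forall eps : R, 0 < eps ->
    (fun N => P N [set w | eps <= `|X N w - c|]) @ \oo --> 0%E.

(* The domain D is cut into finitely many pieces, on the interior of each of
   which f is differentiable. *)
Definition piecewise_differentiable (R : realType) (D : set (R * R))
    (f : R * R -> R) : Prop :=
  exists (n : nat) (U : 'I_n -> set (R * R)),
    [/\ forall i, open (U i) /\ U i `<=` D,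
        trivIset setT U,
        D `<=` \bigcup_(i in setT) closure (U i)
      & forall i p, U i p -> differentiable f p].

Definition height_domain (R : realType) : set (R * R) :=
  [set p | 0 <= p.1 /\ 0 <= p.2 <= 1].

(* Only the values of h on height_domain matter. *)
Definition is_limit_shape (R : realType) (d : nat -> measure_display)
    (T : forall N, measurableType (d N)) (P : forall N, probability (T N) R)
    (mu : forall N, T N -> N.-tuple (npartition N)) (h : R -> R -> R) : Prop :=
  [/\ {within @height_domain R, continuous (fun p : R * R => h p.1 p.2)},
      piecewise_differentiable (@height_domain R)
        (fun p : R * R => h p.1 p.2),
      forall xi xi' tau, 0 <= xi <= xi' -> 0 <= tau <= 1 ->
        h xi' tau <= h xi tau,
      forall xi tau tau', 0 <= xi -> 0 <= tau -> tau <= tau' <= 1 ->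
        h xi tau' <= h xi tau
    & forall xi tau, 0 <= xi -> 0 < tau <= 1 ->
        cvg_in_probability P
          (fun N w => (height (mu N w) (Num.truncn (xi * N%:R))
                                       (Num.truncn (tau * N%:R)))%:R / N%:R)
          (h xi tau)].

(* Main.v *)
(* By a Lindstroem-Gessel-Viennot cancellation, G_lambda(x) * dual G_lambda(y)
   is the total weight of the Schur process configurations with mu^t_t = lambda_t
   for all t: the columns (1 - beta x)^(j-1) and (1 - beta/y)^(N-j) expand into
   the Bernoulli jumps of particle j before and after level j.  Hence lambda has
   the law of the diagonal (mu^t_t), and lambda_t + N - t >= a iff H_N(a, t) >= t.
   As h is weakly decreasing in tau, the equation h xi tau = tau has at most one
   solution tau for each xi; since L is continuous, h xi tau - tau changes sign
   exactly at xi = L tau when 0 < tau < 1.  For tau = 1 one needs L 1 = 0: the last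
   level of the process is a Schur measure, and the Pieri rule shows that with high
   probability a positive fraction of the rows of mu^N is empty. *)

Require Import Defs.
From HB Require Import structures.
From mathcomp Require Import all_boot all_order all_algebra all_fingroup.
From mathcomp Require Import all_classical all_reals all_analysis.
From mathcomp Require Import(canonicals, coercions) mpoly.
From mathcomp Require Import zify ring lra.
From mathcomp Require polyrcf.

Set Implicit Arguments.
Unset Strict Implicit.
Unset Printing Implicit Defensive.

Import Order.TTheory GRing.Theory Num.Theory.
Import numFieldNormedType.Exports.

Local Open Scope ring_scope.

(** * Non-intersecting jumps *)

(** The two determinants are expanded separately, so at first the jumps of different particles are
    independent and particles may collide. Each particle is pinned on its own level, so the paths
    have no common starting level: two neighbours that meet must exchange their jumps on the side
    away from both pinned levels. Such a side exists because the pinned levels of neighbours differ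
    by at most one. Instead of selecting a canonical collision, all possible collisions are ranked
    and excluded one at a time, from the pinned levels outwards.

    The pinned levels stay a parameter [delta], so that the same identity also yields the Schur law
    of the last level. Normalising constants are matched through total mass: two proportional
    probability laws coincide.

    The separate treatment of tau = 1 has its reason in the sign argument: below [L tau] it compares
    with values s > tau, and none is left when tau = 1. *)

Lemma sum_cancel (R : numDomainType) (T : finType) (I : eqType) (s : seq I)
    (r : I -> nat) (c : I -> pred T) (phi : I -> T -> T) (f : T -> R) :
  (forall i, involutive (phi i)) ->
  (forall i e, i \in s -> ~~ c i e -> f (phi i e) = - f e) ->
  (forall i k e, i \in s -> k \in s -> (r i <= r k)%N ->
     c i (phi k e) = c i e) ->
  \sum_e f e = \sum_(e | all (c^~ e) s) f e.
Proof.
move=> phiK phiN phiC; pose s' := sort (relpre r leq) s.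
have memE i : (i \in s') = (i \in s) by rewrite mem_sort.
under [RHS]eq_bigl => e do rewrite -(all_sort _ (relpre r leq)) -/s'.
have: pairwise (relpre r leq) s'.
  rewrite -sorted_pairwise; first by apply: sort_sorted => x y; exact: leq_total.
  by move=> x y z; apply: leq_trans.
have: {subset s' <= s} by move=> i; rewrite memE.
(* Conditions are added in order of increasing rank. On the terms that violate the newest one, its
   involution flips the sign of [f] and preserves both this violation and the earlier conditions, so
   these terms sum to 0. *)
elim/last_ind: s' {memE} => [|s' k IH] sub pw; first exact: eq_bigl.
have kins : k \in s by apply: sub; rewrite mem_rcons mem_head.
move: pw; rewrite pairwise_rcons => /andP[/allP pk pw].
have sub' : {subset s' <= s}.
  by move=> i si; apply: sub; rewrite mem_rcons inE si orbT.
rewrite IH // (bigID (c k)) /= [X in _ + X](_ : _ = 0) ?addr0.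
  by apply: eq_bigl => e; rewrite all_rcons andbC.
set S := LHS; suff : S = - S by move/eqP; rewrite -addr_eq0 -mulr2n mulrn_eq0 => /eqP.
rewrite {1}/S (reindex_inj (inv_inj (phiK k))) /= -sumrN.
have cE e : all (c^~ (phi k e)) s' && ~~ c k (phi k e) =
            all (c^~ e) s' && ~~ c k e.
  rewrite (phiC k k) //; congr (_ && _); apply: eq_in_all => i si.
  by rewrite phiC // ?sub' //; exact: pk.
rewrite (eq_bigl _ _ cE); apply: eq_bigr => e /andP[_ cke].
by rewrite phiN.
Qed.

Section Jumps.
Variables (N n : nat) (ell delta : 'I_N -> nat).
Implicit Types (e : {set 'I_n * 'I_N}) (t : nat) (j a b : 'I_N).

Definition njumps e (p : nat -> 'I_N -> bool) (j : 'I_N) : nat :=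
  (\sum_(s < n) (p s j && ((s, j) \in e)))%N.

(* Particle j sits at ell j on level delta j; an element (s, j) of e says
   that it is one unit higher on level s than on level s + 1. *)
Definition position e t : {ffun 'I_N -> nat} :=
  [ffun j => ell j + njumps e (fun s j => t <= s < delta j) j
             - njumps e (fun s j => delta j <= s < t) j]%N.

Lemma njumps_le e lo hi j :
  (njumps e (fun s _ => lo <= s < hi) j <= hi - lo)%N.
Proof.
rewrite /njumps; apply: (@leq_trans (\sum_(s < n | lo <= s < hi) 1)%N).
  by rewrite [leqRHS]big_mkcond; apply: leq_sum => s _;
    case: (lo <= s < hi)%N; case: (_ \in _).
rewrite -(big_mkord (fun s => lo <= s < hi)%N (fun=> 1%N)) sum1_count.
rewrite -(size_filter).
have -> : (hi - lo)%N = size (iota lo (hi - lo)) by rewrite size_iota.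
apply: uniq_leq_size; first by rewrite filter_uniq // iota_uniq.
move=> s; rewrite mem_filter mem_iota => /andP[/andP[h1 h2] _].
by rewrite h1 /=; lia.
Qed.

Hypothesis delta_le : forall j, (delta j <= n)%N.
Hypothesis ell_ge : forall j, (n - delta j <= ell j)%N.

(** [ell_ge] leaves room for every downward step after level [delta j], so the truncated subtraction
    in [position] is exact. *)
Lemma positionS e (s : 'I_n) j :
  position e s j = (position e s.+1 j + ((s, j) \in e))%N.
Proof.
rewrite !ffunE; have [lt_s|le_s] := ltnP s (delta j).
- have z0 t : (t <= delta j)%N ->
      njumps e (fun s j => delta j <= s < t)%N j = 0%N.
    by move=> h; rewrite /njumps big1 // => i _; case: andP => // -[/andP[]]; lia.
  rewrite !z0 ?subn0 //; last exact: ltnW.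
  rewrite -addnA; congr (_ + _)%N; rewrite /njumps (bigD1 s) //= leqnn lt_s /= addnC.
  rewrite [in RHS](bigD1 s) //= ltnn add0n; congr (_ + _)%N.
  apply: eq_bigr => i ne; congr (nat_of_bool (_ && _)).
  by move: ne; rewrite -val_eqE /=; lia.
- have z0 t : (delta j <= t)%N -> njumps e (fun s j => t <= s < delta j)%N j = 0%N.
    by move=> h; rewrite /njumps big1 // => i _; case: andP => // -[/andP[]]; lia.
  rewrite !z0 ?addn0 //; last exact: ltnW.
  have le2 := njumps_le e (delta j) s.+1 j.
  have le3 := ell_ge j; have := ltn_ord s => le4.
  suff E : njumps e (fun s0 _ => delta j <= s0 < s.+1)%N j =
         (njumps e (fun s0 _ => delta j <= s0 < s)%N j + ((s, j) \in e))%N.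
    move: E le2; rewrite /njumps; lia.
  rewrite /njumps (bigD1 s) //= leqnn le_s /= addnC.
  rewrite [in RHS](bigD1 s) //= ltnn andbF add0n; congr (_ + _)%N.
  apply: eq_bigr => i ne; congr (nat_of_bool (_ && _)).
  by move: ne; rewrite -val_eqE /=; lia.
Qed.

Lemma position_pinned e j : position e (delta j) j = ell j.
Proof.
rewrite ffunE /njumps !big1 ?addn0 ?subn0 // => i _; case: andP => // -[/andP[]]; lia.
Qed.

Definition swap_jumps (S : pred nat) a b e :=
  [set q : 'I_n * 'I_N | (q.1, if S q.1 then tperm a b q.2 else q.2) \in e].

Lemma swap_jumpsK S a b : involutive (swap_jumps S a b).
Proof.
move=> e; apply/setP => -[s j]; rewrite !inE /=.
by case: (S s); rewrite // tpermK.
Qed.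

Lemma card_swap_jumps S a b e : #|swap_jumps S a b e| = #|e|.
Proof.
pose f (q : 'I_n * 'I_N) : 'I_n * 'I_N :=
  (q.1, if S (nat_of_ord q.1) then tperm a b q.2 else q.2).
have fK : involutive f.
  by move=> [s j]; rewrite /f /=; case: (S s); rewrite // tpermK.
by rewrite -[RHS](card_preimset _ (inv_inj fK)).
Qed.


Lemma in_swap S a b e s j :
  ((s, j) \in swap_jumps S a b e) =
  ((s, if S s then tperm a b j else j) \in e).
Proof. by rewrite inE. Qed.

Lemma position_swap_id (S : pred nat) a b e t j :
  (forall s, S s -> (t <= s < delta j)%N || (delta j <= s < t)%N ->
     j <> a /\ j <> b) ->
  position (swap_jumps S a b e) t j = position e t j.
Proof.
move=> H; rewrite !ffunE /njumps.
congr (_ + _ - _)%N; apply: eq_bigr => s _; rewrite in_swap;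
  case: (boolP (S s)) => //= Ss.
- case: (boolP (t <= s < delta j)%N) => //= ts.
  have := H s Ss; rewrite ts => /(_ isT)[/eqP ja /eqP jb].
  by rewrite tpermD // eq_sym.
- case: (boolP (delta j <= s < t)%N) => //= ts.
  have := H s Ss; rewrite ts orbT => /(_ isT)[/eqP ja /eqP jb].
  by rewrite tpermD // eq_sym.
Qed.

Lemma position_sum e t t' j : (t <= t' <= n)%N ->
  position e t j = (position e t' j + njumps e (fun s _ => t <= s < t')%N j)%N.
Proof.
move=> /andP[]; elim: t' => [|t' IH] tt' t'n.
  by rewrite (_ : t = 0%N) 1?/njumps ?big1 ?addn0 //; lia.
have [-> | ntt'] := eqVneq t t'.+1.
  by rewrite /njumps big1 ?addn0 // => i _; case: andP => // -[/andP[]]; lia.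
rewrite IH; [|lia|lia]; rewrite (positionS e (Ordinal t'n)) /= -addnA; congr (_ + _)%N.
rewrite /njumps (bigD1 (Ordinal t'n)) //= ltnn andbF add0n.
rewrite [in RHS](bigD1 (Ordinal t'n)) //=; have -> : (t <= t' < t'.+1)%N by lia.
congr (_ + _)%N.
apply: eq_bigr => i ne; congr (nat_of_bool (_ && _)).
by move: ne; rewrite -val_eqE /=; lia.
Qed.

Lemma tperm_eqfun (T : eqType) (f : 'I_N -> T) a b j : f a = f b -> f (tperm a b j) = f j.
Proof. by move=> fab; case: tpermP => // ->. Qed.

(** Both particles occupy the same place on level t, so trading all jumps below t interchanges the
    places where they end on level 0. *)
Lemma position_swap_lower a b e t :
  (t <= delta a)%N -> (t <= delta b)%N -> (t <= n)%N ->
  position e t a = position e t b ->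
  position (swap_jumps (fun s => s < t)%N a b e) 0 =
    [ffun j => position e 0 (tperm a b j)].
Proof.
move=> ta tb tn ab; apply/ffunP => j; rewrite [RHS]ffunE.
rewrite !(@position_sum _ 0 t) ?tn // (tperm_eqfun _ ab); congr (_ + _)%N.
  by apply: position_swap_id => s /= st h; split=> ja; rewrite ja in h; lia.
rewrite /njumps; apply: eq_bigr => s _; rewrite in_swap /=.
by case: (s < t)%N.
Qed.

Lemma position_swap_upper a b e t :
  (delta a <= t)%N -> (delta b <= t)%N -> (t <= n)%N ->
  position e t a = position e t b ->
  position (swap_jumps (leq t) a b e) n =
    [ffun j => position e n (tperm a b j)].
Proof.
move=> ta tb tn ab; apply/ffunP => j; rewrite [RHS]ffunE.
set e' := swap_jumps _ _ _ _.
have := @position_sum e t n (tperm a b j); have := @position_sum e' t n j.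
rewrite !tn !leqnn => /(_ isT) h1 /(_ isT); rewrite (tperm_eqfun _ ab).
have <- : position e' t j = position e t j.
  by apply: position_swap_id => s /= st h; split=> ja; rewrite ja in h; lia.
rewrite h1; have -> : njumps e' (fun s _ => t <= s < n)%N j =
  njumps e (fun s _ => t <= s < n)%N (tperm a b j); last by move/addIn.
rewrite /njumps; apply: eq_bigr => s _; rewrite in_swap /=.
by case: (t <= s)%N.
Qed.

Definition strict_positions e :=
  [forall t : 'I_n.+1, [forall a : 'I_N, [forall b : 'I_N,
     (b == a.+1 :> nat) ==> (position e t b < position e t a)%N]]].

Hypothesis ell_lt : forall a b, b = a.+1 :> nat -> (ell b < ell a)%N.
Hypothesis delta_step : forall a b, b = a.+1 :> nat ->
  (delta a <= delta b <= (delta a).+1)%N.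

(** Neighbours are strictly ordered on level [delta a], where one extra jump of b can at most close
    the gap. From level to level their distance changes by at most 1, so they cannot change order
    without meeting. *)
Lemma strict_positionsP e :
  (forall t a b, (t <= n)%N -> b = a.+1 :> nat ->
     position e t a != position e t b) ->
  strict_positions e.
Proof.
move=> ne; apply/forallP => t; apply/forallP => a; apply/forallP => b.
apply/implyP => /eqP ba.
have base : (position e (delta a) b < position e (delta a) a)%N.
  have := ne (delta a) a b (delta_le a) ba.
  rewrite position_pinned; have := ell_lt ba; have /andP[] := delta_step ba.
  rewrite leq_eqVlt => /orP[/eqP dab|lt_ab].
    by rewrite dab position_pinned.
  move=> le_ab; have dn : (delta a < n)%N by apply: leq_trans lt_ab (delta_le b).
  have E : delta b = (delta a).+1 by lia.
  by rewrite (positionS e (Ordinal dn)) /= -E position_pinned; case: (_ \in _) => /=; lia.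
have down k : (position e (delta a - k) b < position e (delta a - k) a)%N.
  elim: k => [|k IH]; first by rewrite subn0.
  have [lk|gk] := leqP (delta a) k.
    by move: IH; have -> : (delta a - k.+1 = delta a - k)%N by lia.
  have hn : (delta a - k.+1 < n)%N by have := delta_le a; lia.
  have := ne (delta a - k.+1)%N a b (ltnW hn) ba.
  rewrite !(positionS e (Ordinal hn)) /=.
  have -> : ((delta a - k.+1).+1 = delta a - k)%N by lia.
  by case: (_ \in _); case: (_ \in _) => /=; lia.
have up k : (delta a + k <= n)%N ->
    (position e (delta a + k) b < position e (delta a + k) a)%N.
  elim: k => [|k IH] hk; first by rewrite addn0.
  have hn : (delta a + k < n)%N by lia.
  have := ne (delta a + k.+1)%N a b hk ba.
  have := IH (ltnW hn); rewrite !(positionS e (Ordinal hn)) /= addnS.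
  by case: (_ \in _); case: (_ \in _) => /=; lia.
have [ta|/ltnW at_] := leqP t (delta a).
  by have -> : t = (delta a - (delta a - t))%N :> nat; [lia|exact: down].
have -> : t = (delta a + (t - delta a))%N :> nat by lia.
by apply: up; have := ltn_ord t; lia.
Qed.

Definition antisymmetric (R : zmodType) (F : {ffun 'I_N -> nat} -> R) :=
  forall a b (z : {ffun _ -> nat}), a != b -> F [ffun j => z (tperm a b j)] = - F z.

(* Two particles that meet on level t exchange their jumps on the side of t away
   from their pinned levels. *)
Lemma sum_strict_positions (R : numDomainType) (c : R)
    (F G : {ffun 'I_N -> nat} -> R) :
  antisymmetric F -> antisymmetric G ->
  \sum_(e : {set 'I_n * 'I_N})
      c ^+ #|e| * F (position e 0) * G (position e n) =
  \sum_(e | strict_positions e)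
      c ^+ #|e| * F (position e 0) * G (position e n).
Proof.
move=> antiF antiG.
pose I : finType := (bool * 'I_n.+1 * 'I_N * 'I_N)%type.
pose lw (i : I) := i.1.1.1; pose tm (i : I) : nat := i.1.1.2.
pose pa (i : I) := i.1.2; pose pb (i : I) := i.2.
(* Both particles are pinned on the same side of level [tm i]. Since neighbouring pinned levels
   differ by at most 1, every level falls under one of the two cases. *)
pose ok (i : I) := (pb i == (pa i).+1 :> nat) &&
  if lw i then ((tm i <= delta (pa i)) && (tm i <= delta (pb i)))%N
  else ((delta (pa i) <= tm i) && (delta (pb i) <= tm i))%N.
(* The rank grows outwards, and an exchange alters only levels strictly farther out than its own.
   Exchanges of opposite kinds do not disturb each other: a particle common to both is pinned
   between the two levels. *)
pose r (i : I) := if lw i then (n - tm i)%N else tm i.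
pose C (i : I) e := position e (tm i) (pa i) != position e (tm i) (pb i).
pose S (i : I) s := if lw i then (s < tm i)%N else (tm i <= s)%N.
pose phi (i : I) := swap_jumps (S i) (pa i) (pb i).
have tn i : (tm i <= n)%N by rewrite -ltnS; exact: ltn_ord.
have okP i : (i \in seq.filter ok (enum I)) = ok i by rewrite mem_filter mem_enum andbT.
have abn i : ok i -> pa i != pb i.
  by move=> /andP[/eqP h _]; apply/eqP => ab; move: h; rewrite ab; lia.
rewrite (sum_cancel (s := seq.filter ok (enum I)) (r := r) (c := C) (phi := phi)).
- apply: eq_bigl => e; apply/idP/idP.
    move=> /allP H; apply: strict_positionsP => t a b lt_t ba.
    pose i x : I := (x, Ordinal (lt_t : t < n.+1)%N, a, b).
    have /andP[d1 d2] := delta_step ba.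
    have [ta|at_] := leqP t (delta a).
      by apply: (H (i true)); rewrite okP /ok /lw /tm /pa /pb /=; lia.
    by apply: (H (i false)); rewrite okP /ok /lw /tm /pa /pb /=; lia.
  move=> H; apply/allP => i; rewrite okP => /andP[ba _].
  move/forallP: H => /(_ i.1.1.2) /forallP /(_ (pa i)) /forallP /(_ (pb i)).
  by rewrite ba /= ltn_neqAle eq_sym => /andP[].
- by move=> i; exact: swap_jumpsK.
- move=> i e; rewrite okP => oki; rewrite /C negbK => /eqP ab.
  rewrite /phi card_swap_jumps; move: (abn _ oki) (oki) => nab /andP[ba].
  rewrite /S; case: (lw i) => /andP[ta tb].
    rewrite (position_swap_lower ta tb (tn i) ab) antiF // mulrN mulNr.
    congr (- (_ * G _)); apply/ffunP => j.
    apply: position_swap_id => s /= st h.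
    have := delta_le (pa i); have := delta_le (pb i).
    by split=> ja; rewrite ja in h; lia.
  rewrite (position_swap_upper ta tb (tn i) ab) antiG // mulrN.
  congr (- (_ * F _ * _)); apply/ffunP => j.
  by apply: position_swap_id => s /= st h; split=> ja; rewrite ja in h; lia.
- move=> i k e; rewrite !okP => oki okk; rewrite /r => rik.
  have E j : j = pa i \/ j = pb i ->
      position (phi k e) (tm i) j = position e (tm i) j.
    move=> ji; apply: position_swap_id => s Ss h.
    have [tni tnk] := (tn i, tn k).
    move: oki okk rik Ss; rewrite /ok /S.
    by case: (lw i); case: (lw k) => /andP[_ /andP[i1 i2]] /andP[_ /andP[k1 k2]] rik Ss;
    split=> jk; rewrite jk in h; case: ji => ji; rewrite ?jk in ji;
    rewrite -?ji in i1 i2; lia.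
  by rewrite /C !E //; [right|left].
Qed.

End Jumps.

(** * Alternants and the Vandermonde product *)

Section Alternants.
Variables (K : comNzRingType) (N : nat).
Implicit Types (x : 'I_N -> K).

Lemma det_relabel (A : 'M[K]_N) (f : 'I_N -> 'I_N) : injective f ->
  \det (\matrix_(i, j) A (f i) (f j)) = \det A.
Proof.
move=> inj; pose s := perm inj.
have -> : \matrix_(i, j) A (f i) (f j) = row_perm s (col_perm s A).
  by apply/matrixP => i j; rewrite !mxE /s !permE.
rewrite row_permE col_permE !det_mulmx !det_perm odd_permV mulrCA.
by rewrite -signr_addb addbb mulr1.
Qed.

Lemma det_vandermonde x :
  \det (\matrix_(i < N, j < N) x i ^+ (N - j.+1)) =
  \prod_(i < N) \prod_(j < N | (i < j)%N) (x i - x j).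
Proof.
pose a : 'rV[K]_N := \row_i x (rev_ord i).
rewrite -det_tr.
have -> : (\matrix_(i < N, j < N) x i ^+ (N - j.+1))^T =
    \matrix_(i, j) Vandermonde N a (rev_ord i) (rev_ord j).
  by apply/matrixP => i j; rewrite !mxE /= rev_ordK.
rewrite det_relabel; last exact: rev_ord_inj.
rewrite det_Vandermonde (reindex_inj rev_ord_inj) /=.
rewrite [RHS](exchange_big_dep xpredT) //=; apply: eq_bigr => i _.
rewrite (reindex_inj rev_ord_inj) /=; apply: eq_big => j.
  by have := ltn_ord i; have := ltn_ord j; lia.
by rewrite !mxE !rev_ordK.
Qed.

(* Reducing each f j modulo prod_i (X - x i) does not change its values at the
   x i, and turns the matrix into a Vandermonde matrix times a coefficient matrix. *)
Lemma vandermonde_dvd_alternant x (f : 'I_N -> {poly K}) :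
  exists c, \det (\matrix_(i < N, j < N) (f j).[x i]) =
    c * \prod_(i < N) \prod_(j < N | (i < j)%N) (x i - x j).
Proof.
pose P := \prod_(i < N) ('X - (x i)%:P).
have Pm : P \is monic by exact: monic_prod_XsubC.
have sP : size P = N.+1.
  by rewrite /P size_prod_XsubC /index_enum -enumT size_enum_ord.
pose C := \matrix_(k < N, j < N) (Pdiv.Ring.rmodp (f j) P)`_(N - k.+1).
exists (\det C); rewrite -det_vandermonde mulrC -det_mulmx; congr (\det _).
apply/matrixP => i j; rewrite !mxE.
rewrite [in LHS](Pdiv.RingMonic.rdivp_eq Pm (f j)) hornerD hornerM.
have -> : P.[x i] = 0.
  by rewrite /P horner_prod (bigD1 i) //= hornerXsubC subrr mul0r.
rewrite mulr0 add0r (@horner_coef_wide _ N); last first.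
  by rewrite -ltnS -sP Pdiv.Ring.ltn_rmodpN0 // monic_neq0.
rewrite (reindex_inj rev_ord_inj) /=; apply: eq_bigr => k _.
by rewrite !mxE mulrC.
Qed.

End Alternants.

(** * Expansion of determinants over sets of jumps *)

Section Expansion.
Variables (K : comNzRingType) (n N : nat).
Implicit Types (e P : {set 'I_n * 'I_N}).

Definition column_card e (j : 'I_N) : nat := (\sum_(s < n) ((s, j) \in e))%N.

Lemma card_columns e : #|e| = (\sum_j column_card e j)%N.
Proof.
rewrite exchange_big pair_big /= -sum1_card big_mkcond /=.
by apply: eq_bigr => -[s j] _ /=; case: (_ \in _).
Qed.

Lemma prod_columns P (u : 'I_N -> K) :
  \prod_(q in P) u q.2 = \prod_j u j ^+ column_card P j.
Proof.
under [RHS]eq_bigr => j _ do rewrite -prodrXr.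
rewrite exchange_big pair_big /= big_mkcond /=.
by apply: eq_bigr => -[s j] _ /=; case: (_ \in _).
Qed.

Lemma prod_add_columns P (u v : 'I_N -> K) :
  \prod_j (u j + v j) ^+ column_card P j =
  \sum_(e : {set 'I_n * 'I_N} | e \subset P)
     \prod_j (u j ^+ column_card e j * v j ^+ column_card (P :\: e) j).
Proof.
rewrite -prod_columns big_mkcond /=.
(* Outside [P] the factor 1 is split as 0 + 1, so that sets not contained in [P] contribute 0. *)
have -> : \prod_q (if q \in P then u q.2 + v q.2 else 1) =
  \prod_q ((if q \in P then u q.2 else 0) + (if q \in P then v q.2 else 1)).
  by apply: eq_bigr => q _; case: (q \in P); rewrite ?add0r.
rewrite bigA_distr [RHS]big_mkcond /=; apply: eq_bigr => e _.
case: (boolP (e \subset P)) => [eP|/subsetPn[q qe qP]]; last first.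
  by rewrite (bigD1 q) //= qe (negbTE qP) mul0r.
rewrite big_split /= -!prod_columns (big_mkcond (fun q => q \in e)).
rewrite (big_mkcond (fun q => q \in P :\: e)) -big_split /=.
apply: eq_bigr => q _; rewrite !inE; case: (boolP (q \in e)) => qe /=.
  by rewrite (fintype.subsetP eP _ qe) mulr1.
by rewrite mul1r.
Qed.

Lemma det_columns (A : 'M[K]_N) :
  \det A = \sum_(s : 'S_N) (-1) ^+ s * \prod_j A (s j) j.
Proof.
by rewrite -det_tr; apply: eq_bigr => s _; congr (_ * _); apply: eq_bigr => j _; rewrite mxE.
Qed.

(** The subset chosen in a column is common to all rows, so each choice yields a single determinant.
    Summing over subsets instead of using binomial coefficients makes every term one configuration
    of jumps. *)
Lemma det_expand P (u v : 'I_N -> K) (w : 'I_N -> 'I_N -> K) :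
  \det (\matrix_(i, j) (w i j * (u i + v i) ^+ column_card P j)) =
  \sum_(e : {set 'I_n * 'I_N} | e \subset P)
    \det (\matrix_(i, j) (w i j * (u i ^+ column_card e j
                                   * v i ^+ column_card (P :\: e) j))).
Proof.
under [RHS]eq_bigr => e _ do rewrite det_columns.
rewrite exchange_big det_columns /=; apply: eq_bigr => s _.
under [in LHS]eq_bigr => j _ do rewrite mxE.
rewrite big_split /= (prod_add_columns P (fun j => u (s j)) (fun j => v (s j))).
rewrite !mulr_sumr; apply: eq_bigr => e _; rewrite -big_split /=.
by congr (_ * _); apply: eq_bigr => j _; rewrite mxE.
Qed.

Lemma det_scale_columns (c : K) (k : 'I_N -> nat) (A : 'M[K]_N) :
  \det (\matrix_(i, j) (c ^+ k j * A i j)) = c ^+ (\sum_j k j) * \det A.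
Proof.
rewrite !det_columns mulr_sumr; apply: eq_bigr => s _.
under eq_bigr => j _ do rewrite mxE.
by rewrite big_split /= prodrXr mulrCA.
Qed.

End Expansion.

(** Merges a choice of jumps below the pinned levels with an independent choice above them into one
    arbitrary set of jumps. *)
Lemma sum_subset_split (K : comNzRingType) (T : finType) (P : {set T})
    (f g : {set T} -> K) :
  (\sum_(e : {set T} | e \subset P) f e) * (\sum_(e : {set T} | e \subset ~: P) g e) =
  \sum_(e : {set T}) f (e :&: P) * g (e :\: P).
Proof.
rewrite big_distrlr pair_big /=.
rewrite (reindex_onto (fun e : {set T} => (e :&: P, e :\: P)) (fun q => q.1 :|: q.2)) /=.
  apply: eq_bigl => e; rewrite finset.subsetIr finset.setDE finset.subsetIr /= -finset.setDE.
  by rewrite finset.setID eqxx.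
move=> -[e1 e2] /= /andP[s1 s2]; congr (_, _).
  rewrite finset.setIUl (finset.setIidPl s1) (_ : e2 :&: P = finset.set0) ?finset.setU0 //.
  by apply/eqP; rewrite finset.setI_eq0 finset.disjoints_subset.
rewrite finset.setDUl (_ : e1 :\: P = finset.set0) ?finset.set0U;
  last by apply/eqP; rewrite finset.setD_eq0.
by apply/finset.setDidPl; rewrite finset.disjoints_subset.
Qed.

Local Open Scope classical_set_scope.

(** * Schur polynomials at equal arguments *)

Section SchurAt.
Variables (R : realType) (N : nat).
Local Notation mpolyR := (mpoly.mpoly N R).
Implicit Types (l : {ffun 'I_N -> nat}).

Lemma meval_mvar (v : 'I_N -> R) i : mpoly.meval v (mvar R i) = v i.
Proof. exact: mpoly.mevalXU. Qed.

Lemma vandermonde_neq0 : vandermonde R N != 0.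
Proof.
apply/prodf_neq0 => i _; apply/prodf_neq0 => j ij.
apply/eqP => /(congr1 (mpoly.meval (fun k => (k == i)%:R))).
rewrite mpoly.mevalB mpoly.meval0 !meval_mvar eqxx.
have -> : (j == i) = false by rewrite -val_eqE /=; lia.
by rewrite subr0 => /eqP; rewrite oner_eq0.
Qed.

Lemma alternant_quotientE (A : 'M[mpolyR]_N) g :
  g * vandermonde R N = \det A -> alternant_quotient A = g.
Proof.
move=> gA; apply: (mulIf vandermonde_neq0); rewrite gA.
by rewrite /alternant_quotient; case: xgetP => [y _ <-|/(_ g)].
Qed.

Definition alternant l : 'M[mpolyR]_N := \matrix_(i, j) mvar R i ^+ l j.

Lemma alternant_quotientK l :
  alternant_quotient (alternant l) * vandermonde R N = \det (alternant l).
Proof.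
have [c cE] := @vandermonde_dvd_alternant mpolyR N (@mvar R N) (fun j => 'X^(l j)).
suff E : c * vandermonde R N = \det (alternant l) by rewrite (alternant_quotientE E).
rewrite -[LHS]cE; congr (\det _); apply/matrixP => i j.
by rewrite !mxE hornerXn.
Qed.

(** For strictly decreasing [l] this is a Schur polynomial at equal arguments. Arbitrary exponents
    are allowed because the expansion passes through unordered configurations, which antisymmetry
    then cancels. *)
Definition schur_at (z : R) l : R :=
  eval_at z (alternant_quotient (alternant l)).

Lemma schur_at_antisymmetric z : antisymmetric (schur_at z).
Proof.
move=> a b l ab; rewrite /schur_at /eval_at -mpoly.mevalN; congr (mpoly.meval _ _).
apply: alternant_quotientE; rewrite mulNr alternant_quotientK.
have -> : alternant [ffun j => l (tperm a b j)] = col_perm (tperm a b) (alternant l).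
  by apply/matrixP => i j; rewrite !mxE ffunE.
by rewrite col_permE det_mulmx det_perm tpermV odd_tperm ab mulrN1.
Qed.

(* At the points z t^(N-1-i) with t > 1 the value is a positive multiple of a
   quotient of two Vandermonde products; then let t tend to 1. *)
Lemma schur_at_ge0 z l : 0 < z ->
  (forall i j : 'I_N, (i < j)%N -> (l j < l i)%N) -> 0 <= schur_at z l.
Proof.
move=> z0 lS; set q := alternant_quotient (alternant l).
pose u t (i : 'I_N) : R := z * t ^+ (N - i.+1).
pose P : {poly R} := \sum_(m <- mpoly.msupp q)
  (mpoly.mcoeff m q)%:P * \prod_(i < N) (z%:P * 'X^(N - i.+1)) ^+ (m i).
have PE t : P.[t] = mpoly.meval (u t) q.
  rewrite mpoly.mevalE horner_sum; apply: eq_bigr => m _.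
  rewrite hornerM hornerC horner_prod; congr (_ * _); apply: eq_bigr => i _.
  by rewrite horner_exp hornerM hornerC hornerXn.
have -> : schur_at z l = P.[1].
  rewrite PE /schur_at /eval_at; apply: mpoly.meval_eq => i.
  by rewrite /u expr1n mulr1.
have P0 t : 1 < t -> 0 <= P.[t].
  move=> t1; have t0 : 0 < t by lra.
  have := congr1 (mpoly.meval (u t)) (alternant_quotientK l).
  rewrite mpoly.mevalM -/q -PE.
  have -> : mpoly.meval (u t) (vandermonde R N) =
    \prod_(i < N) \prod_(j < N | (i < j)%N) (u t i - u t j).
    rewrite rmorph_prod; apply: eq_bigr => i _; rewrite rmorph_prod; apply: eq_bigr => j _.
    by rewrite rmorphB /= !meval_mvar.
  (* The entries become [z ^+ l j] times a power of [t ^+ l j], so up to scaling the transposed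
     alternant is a Vandermonde matrix in the points [t ^+ l j]. *)
  have -> : mpoly.meval (u t) (\det (alternant l)) =
    z ^+ (\sum_j l j) *
      \prod_(i < N) \prod_(j < N | (i < j)%N) (t ^+ l i - t ^+ l j).
    rewrite -det_map_mx -(det_vandermonde (fun i => t ^+ l i)).
    rewrite -[X in _ * X]det_tr -det_scale_columns.
    congr (\det _); apply/matrixP => i j; rewrite !mxE rmorphXn /= meval_mvar /u.
    by rewrite exprMn exprAC.
  have ltX k1 k2 : (k1 < k2)%N -> t ^+ k1 < t ^+ k2 by move=> h; rewrite ltr_eXn2l.
  set V := \prod_(i < N) _; move=> VE.
  have V0 : 0 < V.
    apply: prodr_gt0 => i _; apply: prodr_gt0 => j ij.
    by rewrite /u -mulrBr mulr_gt0 // subr_gt0 ltX //; have := ltn_ord j; lia.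
  rewrite -(pmulr_lge0 _ V0) VE mulr_ge0 ?exprn_ge0 ?(ltW z0) //.
  apply: prodr_ge0 => i _; apply: prodr_ge0 => j ij.
  by rewrite subr_ge0 ltW // ltX // lS.
rewrite leNgt; apply/negP => Pneg.
have P1 : 0 < - P.[1] by rewrite oppr_gt0.
have [d d0 /(_ (1 + d / 2))] := polyrcf.poly_cont 1 P P1.
have -> : 1 + d / 2 - 1 = d / 2 by lra.
rewrite gtr0_norm; last by rewrite divr_gt0.
have h1 : 1 < 1 + d / 2 by lra.
have h2 : d / 2 < d by lra.
move=> /(_ h2); have := P0 _ h1; rewrite ltr_norml => h /andP[_]; lra.
Qed.

Section Expansions.
Variables (n : nat) (ell delta : 'I_N -> nat) (c z : R).
Hypothesis delta_le : forall j, (delta j <= n)%N.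
Hypothesis ell_ge : forall j, (n - delta j <= ell j)%N.

Definition below : {set 'I_n * 'I_N} := [set q : 'I_n * 'I_N | (q.1 < delta q.2)%N]%SET.

Lemma column_card_below j : column_card below j = delta j.
Proof.
rewrite /column_card; under eq_bigr => s _ do rewrite inE /=.
rewrite -[in RHS](card_ord (delta j)) -sum1_card (big_ord_widen n (fun=> 1%N)) //.
by rewrite [in RHS]big_mkcond.
Qed.

Lemma column_card_above j : column_card (~: below) j = (n - delta j)%N.
Proof.
suff : (column_card (~: below) j + column_card below j = n)%N.
  by rewrite column_card_below; lia.
rewrite -big_split /= -[RHS]card_ord -sum1_card; apply: eq_bigr => s _.
by rewrite inE; case: (_ \in _).
Qed.

Lemma position_below (e : {set 'I_n * 'I_N}) :
  position ell delta (e :&: below) 0 = position ell delta e 0.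
Proof.
apply/ffunP => j; rewrite !ffunE; congr (_ + _ - _)%N; apply: eq_bigr => s _.
  by rewrite !inE /=; case: (_ < delta j)%N; rewrite ?andbT ?andbF.
by rewrite ltn0 andbF.
Qed.

Lemma position_above (e : {set 'I_n * 'I_N}) :
  position ell delta (e :\: below) n = position ell delta e n.
Proof.
apply/ffunP => j; rewrite !ffunE; congr (_ + _ - _)%N; apply: eq_bigr => s _.
  by rewrite leqNgt ltn_ord.
by rewrite !inE /= -leqNgt; case: (delta j <= s)%N; rewrite ?andbT ?andbF.
Qed.

Lemma position0_column (e : {set 'I_n * 'I_N}) j : e \subset below ->
  position ell delta e 0 j = (ell j + column_card e j)%N.
Proof.
move=> /fintype.subsetP eb; rewrite ffunE [X in (_ - X)%N]big1 ?subn0; last first.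
  by move=> s _; rewrite ltn0 andbF.
congr (_ + _)%N; apply: eq_bigr => s _.
by case: (boolP (_ \in e)) => [/eb|]; rewrite ?andbF // inE /= => ->.
Qed.

Lemma positionn_column (e : {set 'I_n * 'I_N}) j : e \subset ~: below ->
  position ell delta e n j = (ell j - column_card e j)%N.
Proof.
move=> /fintype.subsetP eb; rewrite ffunE [X in (_ + X - _)%N]big1 ?addn0; last first.
  by move=> s _; rewrite leqNgt ltn_ord.
congr (_ - _)%N; apply: eq_bigr => s _.
by case: (boolP (_ \in e)) => [/eb|]; rewrite ?andbF // !inE /= -leqNgt ltn_ord => ->.
Qed.

(** Each factor 1 + c x_i of column j is one step of particle j below its pinned level. Choosing c
    x_i raises the exponent by one, and the final exponents are the positions on level 0. *)
Lemma eval_lower_alternant :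
  eval_at z (alternant_quotient
    (\matrix_(i, j) (mvar R i ^+ ell j * (1 + c *: mvar R i) ^+ delta j))) =
  \sum_(e : {set 'I_n * 'I_N} | e \subset below)
    c ^+ #|e| * schur_at z (position ell delta e 0).
Proof.
rewrite (@alternant_quotientE _ (\sum_(e : {set 'I_n * 'I_N} | e \subset below)
    (c%:A : mpolyR) ^+ #|e| * alternant_quotient (alternant (position ell delta e 0)))).
  rewrite /eval_at rmorph_sum; apply: eq_bigr => e eb.
  by rewrite rmorphM rmorphXn /= mpoly.mevalZ mpoly.meval1 mulr1.
rewrite mulr_suml.
under [in RHS]eq_mx => i j do rewrite -column_card_below addrC.
rewrite det_expand; apply: eq_bigr => e eb.
rewrite -mulrA alternant_quotientK card_columns -det_scale_columns; congr (\det _).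
apply/matrixP => i j; rewrite !mxE expr1n mulr1 position0_column // exprD mulrCA.
by rewrite -exprMn mulr_algl.
Qed.

(** Here a factor x_i + c is one step above the pinned level: choosing c lowers the exponent by one
    relative to [ell j], and the final exponents are the positions on level n. *)
Lemma eval_upper_alternant :
  eval_at z (alternant_quotient
    (\matrix_(i, j) (mvar R i ^+ (ell j - (n - delta j))
                     * (mvar R i + c *: 1) ^+ (n - delta j)))) =
  \sum_(e : {set 'I_n * 'I_N} | e \subset ~: below)
    c ^+ #|e| * schur_at z (position ell delta e n).
Proof.
rewrite (@alternant_quotientE _ (\sum_(e : {set 'I_n * 'I_N} | e \subset ~: below)
    (c%:A : mpolyR) ^+ #|e| * alternant_quotient (alternant (position ell delta e n)))).
  rewrite /eval_at rmorph_sum; apply: eq_bigr => e eb.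
  by rewrite rmorphM rmorphXn /= mpoly.mevalZ mpoly.meval1 mulr1.
rewrite mulr_suml.
under [in RHS]eq_mx => i j do rewrite -{2}column_card_above addrC.
rewrite (det_expand _ (fun=> c%:A)); apply: eq_bigr => e eb.
rewrite -mulrA alternant_quotientK card_columns -det_scale_columns; congr (\det _).
apply/matrixP => i j; rewrite !mxE positionn_column // mulrCA -exprD; congr (_ * _ ^+ _).
have : (column_card (~: below :\: e) j + column_card e j = n - delta j)%N.
  rewrite -column_card_above -big_split /=; apply: eq_bigr => s _.
  have := fintype.subsetP eb (s, j); rewrite !inE /=.
  by case: (_ \in e) => [->|] //; case: (_ < _)%N.
by have := ell_ge j; lia.
Qed.

End Expansions.

Lemma alternant_product n (ell delta : 'I_N -> nat) (c x y : R) :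
  (forall j, (delta j <= n)%N) -> (forall j, (n - delta j <= ell j)%N) ->
  (forall a b : 'I_N, b = a.+1 :> nat -> (ell b < ell a)%N) ->
  (forall a b : 'I_N, b = a.+1 :> nat -> (delta a <= delta b <= (delta a).+1)%N) ->
  eval_at x (alternant_quotient
    (\matrix_(i, j) (mvar R i ^+ ell j * (1 + c *: mvar R i) ^+ delta j))) *
  eval_at y (alternant_quotient
    (\matrix_(i, j) (mvar R i ^+ (ell j - (n - delta j))
                     * (mvar R i + c *: 1) ^+ (n - delta j)))) =
  \sum_(e : {set 'I_n * 'I_N} | strict_positions ell delta e)
    c ^+ #|e| * schur_at x (position ell delta e 0)
              * schur_at y (position ell delta e n).
Proof.
move=> dn ln lS dS; rewrite (eval_lower_alternant _ _ _ dn) (eval_upper_alternant _ _ dn ln).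
rewrite sum_subset_split -sum_strict_positions //; try exact: schur_at_antisymmetric.
apply: eq_bigr => e _; rewrite position_below position_above -(cardsID (below n delta) e).
by rewrite exprD mulrACA !mulrA.
Qed.

End SchurAt.

(** * Chains of partitions *)

Section Partitions.
Variable N : nat.
Implicit Types (p q : npartition N) (j : 'I_N).

Lemma part_tnth p j : part p j.+1 = tnth (sval p) j.
Proof. by rewrite /part /= (tnth_nth 0%N). Qed.

Lemma part_mono p (i j : 'I_N) : (i <= j)%N -> (part p j.+1 <= part p i.+1)%N.
Proof.
move=> ij; rewrite /part /=.
have geq_trans : transitive geq by move=> a b c ab bc; exact: leq_trans bc ab.
apply: (sorted_leq_nth geq_trans leqnn 0%N (svalP p)) => //;
  rewrite inE size_tuple; exact: ltn_ord.
Qed.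

Lemma npartition_ext p q : (forall j, part p j.+1 = part q j.+1) -> p = q.
Proof.
move=> pq; apply/val_inj/eq_from_tnth => j /=.
by have := pq j; rewrite !part_tnth.
Qed.

Definition mkpart (f : 'I_N -> nat) : npartition N :=
  insubd (empty_part N : {p : N.-tuple nat | sorted geq p}) (mktuple f).

Lemma mkpartE (f : 'I_N -> nat) j :
  (forall a b : 'I_N, b = a.+1 :> nat -> (f b <= f a)%N) ->
  part (mkpart f) j.+1 = f j.
Proof.
move=> fS; rewrite part_tnth /mkpart (_ : sval _ = mktuple f) ?tnth_mktuple //.
rewrite [LHS]insubdK // unfold_in; apply/(sortedP 0%N) => i; rewrite size_tuple => iN.
have iN' := ltnW iN.
rewrite -[i.+1]/(val (Ordinal iN)) -[X in nth _ _ X]/(val (Ordinal iN')) -!tnth_nth.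
by rewrite !tnth_mktuple; apply: fS.
Qed.

Definition shifted p : {ffun 'I_N -> nat} := [ffun j : 'I_N => part p j.+1 + (N - j.+1)]%N.

Lemma shifted_lt p (a b : 'I_N) : (a < b)%N -> (shifted p b < shifted p a)%N.
Proof.
move=> ab; rewrite !ffunE; have := part_mono p (ltnW ab); have := ltn_ord b.
by lia.
Qed.

Lemma level_tnth (m : N.-tuple (npartition N)) (t : 'I_N) :
  level m t.+1 = tnth m t.
Proof. by rewrite /level /= (tnth_nth (empty_part N)). Qed.

Lemma psizeE p : psize p = (\sum_(j < N) part p j.+1)%N.
Proof. by rewrite /psize big_add1 big_mkord. Qed.

End Partitions.

(** Identifies a row of a chain with [position]: both have the same increments and agree at the
    pinned level. *)
Lemma backward_recurrence (n t0 : nat) (f g d : nat -> nat) :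
  (forall s, (s < n)%N -> f s = (f s.+1 + d s)%N) ->
  (forall s, (s < n)%N -> g s = (g s.+1 + d s)%N) ->
  (t0 <= n)%N -> f t0 = g t0 -> forall t, (t <= n)%N -> f t = g t.
Proof.
move=> fS gS t0n fg0.
have fgn : f n = g n.
  have : forall k, (t0 + k <= n)%N -> f (t0 + k)%N = g (t0 + k)%N.
    elim=> [|k IH] hk; first by rewrite addn0.
    rewrite addnS; have := IH; have := fS (t0 + k)%N; have := gS (t0 + k)%N; lia.
  by move=> /(_ (n - t0)%N); rewrite subnKC // => /(_ (leqnn _)).
move=> t; have : forall k, f (n - k)%N = g (n - k)%N.
  elim=> [|k IH]; first by rewrite subn0.
  have [nk|kn] := leqP n k; first by have -> : (n - k.+1 = n - k)%N by lia.
  have kn' : (n - k.+1 < n)%N by lia.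
  rewrite (fS _ kn') (gS _ kn').
  by rewrite (_ : (n - k.+1).+1 = n - k)%N ?IH //; lia.
by move=> /(_ (n - t)%N) H tn; move: H; rewrite subKn.
Qed.

(* Particle j is pinned at time delta j.  The choice delta j = j describes the
   diagonal of the process, and delta j = N.-1 its last level (levels are
   numbered from 0 here). *)
Section Chains.
Variables (N : nat).
Hypothesis N_gt0 : (0 < N)%N.
Let n := N.-1.
Variable (delta : 'I_N -> nat).
Hypothesis delta_le : forall j, (delta j <= n)%N.
Hypothesis delta_ge : forall j : 'I_N, (j <= delta j)%N.
Hypothesis delta_step : forall a b : 'I_N, b = a.+1 :> nat ->
  (delta a <= delta b <= (delta a).+1)%N.
Implicit Types (p : npartition N) (m : N.-tuple (npartition N)) (e : {set 'I_n * 'I_N}).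

Definition strip_chain m := forall s : 'I_n, vertical_strip (level m s.+1) (level m s.+2).

Definition pinned_chains p : set (N.-tuple (npartition N)) :=
  [set m | strip_chain m /\
           forall j : 'I_N, part (level m (delta j).+1) j.+1 = part p j.+1].

Definition chain_of p e : N.-tuple (npartition N) :=
  mktuple (fun t : 'I_N => mkpart (fun j : 'I_N =>
    position (shifted p) delta e t j - (N - j.+1))%N).

Definition jumps_of m : {set 'I_n * 'I_N} :=
  [set q : 'I_n * 'I_N | part (level m q.1.+1) q.2.+1 != part (level m q.1.+2) q.2.+1]%SET.

Lemma shifted_ge p (j : 'I_N) : (n - delta j <= shifted p j)%N.
Proof. by rewrite ffunE; have := delta_ge j; rewrite /n; lia. Qed.

Lemma shifted_step p (a b : 'I_N) : b = a.+1 :> nat -> (shifted p b < shifted p a)%N.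
Proof. by move=> ba; apply: shifted_lt; rewrite ba. Qed.

Lemma strict_adjacent p e t (a b : 'I_N) : strict_positions (shifted p) delta e ->
  (t <= n)%N -> b = a.+1 :> nat ->
  (position (shifted p) delta e t b < position (shifted p) delta e t a)%N.
Proof.
move=> /forallP H tn ba; have := H (Ordinal (tn : (t < n.+1)%N)).
by move=> /forallP/(_ a)/forallP/(_ b); rewrite ba eqxx.
Qed.

(** Strict order, followed upwards from the last particle, forces this bound; it makes the
    subtraction in [chain_of] exact. *)
Lemma strict_ge p e t (j : 'I_N) : strict_positions (shifted p) delta e -> (t <= n)%N ->
  (N - j.+1 <= position (shifted p) delta e t j)%N.
Proof.
move=> st tn.
suff : forall k (j : 'I_N), (N - j.+1 = k)%N -> (k <= position (shifted p) delta e t j)%N.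
  by apply.
elim=> // k IH i hk.
have iN : (i.+1 < N)%N by lia.
have := IH (Ordinal iN); rewrite /= => /(_ ltac:(lia)) h.
by have := @strict_adjacent p e t i (Ordinal iN) st tn erefl; lia.
Qed.

Lemma part_chain_of p e t (j : 'I_N) : strict_positions (shifted p) delta e -> (t <= n)%N ->
  (part (level (chain_of p e) t.+1) j.+1 + (N - j.+1))%N =
  position (shifted p) delta e t j.
Proof.
move=> st tn; have tN : (t < N)%N by move: tn; rewrite /n; lia.
rewrite (level_tnth _ (Ordinal tN)) tnth_mktuple mkpartE.
  by rewrite subnK // strict_ge.
move=> a b ba /=; have := strict_adjacent st tn ba.
have := strict_ge a st tn; have := ltn_ord b; lia.
Qed.

Lemma chain_of_pinned p e : strict_positions (shifted p) delta e ->
  pinned_chains p (chain_of p e).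
Proof.
move=> st; split=> [s|j]; last first.
  have := part_chain_of j st (delta_le j).
  by rewrite position_pinned ffunE => /addIn.
apply/forallP => j.
have h1 := part_chain_of j st (ltnW (ltn_ord s)).
have h2 := part_chain_of j st (ltn_ord s).
have := positionS (shifted_ge p) e s j.
by case: (_ \in _); lia.
Qed.

Lemma jumps_of_chain p e : strict_positions (shifted p) delta e ->
  jumps_of (chain_of p e) = e.
Proof.
move=> st; apply/setP => -[s j]; rewrite inE /=.
have h1 := part_chain_of j st (ltnW (ltn_ord s)).
have h2 := part_chain_of j st (ltn_ord s).
have := positionS (shifted_ge p) e s j.
by case: (_ \in _); lia.
Qed.

Lemma position_jumps_of p m t (j : 'I_N) : pinned_chains p m -> (t <= n)%N ->
  position (shifted p) delta (jumps_of m) t j =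
  (part (level m t.+1) j.+1 + (N - j.+1))%N.
Proof.
move=> [sm pm].
pose d s := if insub s is Some s' then nat_of_bool ((s', j) \in jumps_of m) else 0%N.
apply: (@backward_recurrence n (delta j) (fun t => position (shifted p) delta (jumps_of m) t j)
    (fun t => (part (level m t.+1) j.+1 + (N - j.+1))%N) d) => [s sn|s sn||].
- rewrite /d insubT; exact: (positionS (shifted_ge p) (jumps_of m) (Ordinal sn) j).
- rewrite /d insubT /= inE /=; have := forallP (sm (Ordinal sn)) j; move=> /=; lia.
- exact: delta_le.
- by rewrite position_pinned ?pm ?ffunE.
Qed.

(** A pinned chain is recovered from [jumps_of], since the pinned parts fix one value in each row
    and the jumps give the increments. Strictness holds because every level is a partition. *)
Lemma pinned_chainsE p : pinned_chains p =
  chain_of p @` [set e | strict_positions (shifted p) delta e].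
Proof.
apply/seteqP; split => [m mp|_ [e st <-]]; last exact: chain_of_pinned.
have st : strict_positions (shifted p) delta (jumps_of m).
  apply/forallP => t; apply/forallP => a; apply/forallP => b; apply/implyP => /eqP ba.
  have tn : (t <= n)%N by rewrite -ltnS; exact: ltn_ord.
  rewrite (position_jumps_of _ mp tn) (position_jumps_of _ mp tn).
  have ab : (a <= b)%N by rewrite ba.
  by have := part_mono (level m t.+1) ab; have := ltn_ord b; lia.
exists (jumps_of m) => //; apply: eq_from_tnth => t; apply: npartition_ext => j.
have tn : (t <= n)%N by have := ltn_ord t; rewrite /n; lia.
have := part_chain_of j st tn; rewrite (position_jumps_of _ mp) // => /addIn.
by rewrite !level_tnth.
Qed.

Lemma chain_of_inj p e e' : strict_positions (shifted p) delta e ->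
  strict_positions (shifted p) delta e' -> chain_of p e = chain_of p e' -> e = e'.
Proof.
by move=> st st' ee'; rewrite -(jumps_of_chain st) -(jumps_of_chain st') ee'.
Qed.

Variable R : realType.
Implicit Types (x y beta : R).

Lemma eval_schur_poly x p : eval_at x (schur_poly R p) = schur_at x (shifted p).
Proof.
rewrite /schur_at /schur_poly /alternant; congr (eval_at _ (alternant_quotient _)).
by apply/matrixP => i j; rewrite !mxE ffunE.
Qed.

Lemma process_product m beta :
  \prod_(1 <= k < N)
       ((- beta) ^ ((psize (level m k))%:Z - (psize (level m k.+1))%:Z)
        * (vertical_strip (level m k) (level m k.+1))%:R) =
  \prod_(s < n)
       ((- beta) ^ ((psize (level m s.+1))%:Z - (psize (level m s.+2))%:Z)
        * (vertical_strip (level m s.+1) (level m s.+2))%:R).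
Proof. by rewrite big_add1 big_mkord. Qed.

Lemma weight_not_strip x y beta m :
  ~ strip_chain m -> schur_process_weight x y beta m = 0.
Proof.
move=> /existsNP[s /negP ns]; rewrite /schur_process_weight process_product.
by rewrite (bigD1 s) //= (negbTE ns) mulr0 mul0r mulr0 mul0r.
Qed.

Lemma weight_chain_of x y beta p e : strict_positions (shifted p) delta e ->
  schur_process_weight x y beta (chain_of p e) =
  (- beta) ^+ #|e| * schur_at x (position (shifted p) delta e 0)
                   * schur_at y (position (shifted p) delta e n).
Proof.
move=> st; rewrite /schur_process_weight process_product !eval_schur_poly.
have shE t : (t <= n)%N -> shifted (level (chain_of p e) t.+1) =
    position (shifted p) delta e t.
  by move=> tn; apply/ffunP => j; rewrite -part_chain_of // ffunE.
have -> : level (chain_of p e) N = level (chain_of p e) n.+1 by rewrite /n prednK.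
rewrite !shE // [X in X * _ = _]mulrC; congr (_ * _ * _).
have [sc _] := chain_of_pinned st.
transitivity (\prod_(s < n) (- beta) ^+ (\sum_(j < N) ((s, j) \in e))%N).
  apply: eq_bigr => s _; rewrite sc mulr1 [RHS]exprnP; congr (_ ^ _).
  rewrite !psizeE.
  have E (j : 'I_N) : part (level (chain_of p e) s.+1) j.+1 =
     (part (level (chain_of p e) s.+2) j.+1 + ((s, j) \in e))%N.
    have h1 := part_chain_of j st (ltnW (ltn_ord s)).
    have h2 := part_chain_of j st (ltn_ord s).
    have := positionS (shifted_ge p) e s j.
    by case: (_ \in _); lia.
  rewrite (eq_bigr _ (fun j _ => E j)) big_split /= PoszD; lia.
rewrite prodrXr; congr (_ ^+ _).
by rewrite card_columns /column_card exchange_big.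
Qed.

Lemma sum_strict_weight x y beta p :
  \sum_(e | strict_positions (shifted p) delta e)
     schur_process_weight x y beta (chain_of p e) =
  eval_at x (alternant_quotient
    (\matrix_(i, j) (mvar R i ^+ shifted p j * (1 + (- beta) *: mvar R i) ^+ delta j))) *
  eval_at y (alternant_quotient
    (\matrix_(i, j) (mvar R i ^+ (shifted p j - (n - delta j))
                     * (mvar R i + (- beta) *: 1) ^+ (n - delta j)))).
Proof.
rewrite (alternant_product _ _ _ delta_le (shifted_ge p) (@shifted_step p) delta_step).
by apply: eq_bigr => e st; rewrite weight_chain_of.
Qed.

End Chains.

(** * Grothendieck and Schur specialisations, and a Pieri bound *)

Section Specialisations.
Variables (R : realType) (N : nat).
Implicit Types (x y beta : R) (p : npartition N).

(** Pinning particle j on level j (both from 0) leaves j steps below and [N.-1 - j] above, which are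
    the exponents in the two Grothendieck determinants. *)
Lemma groth_product x y beta p :
  eval_at x (groth_poly beta p) * eval_at y (dual_groth_poly beta p) =
  eval_at x (alternant_quotient
    (\matrix_(i, j) (mvar R i ^+ shifted p j * (1 + (- beta) *: mvar R i) ^+ j))) *
  eval_at y (alternant_quotient
    (\matrix_(i, j) (mvar R i ^+ (shifted p j - (N.-1 - j))
                     * (mvar R i + (- beta) *: 1) ^+ (N.-1 - j)))).
Proof.
have E1 : \matrix_(i < N, j < N) (mvar R i ^+ (part p j.+1 + (N - j.+1))
                             * (1 - beta *: mvar R i) ^+ j) =
    \matrix_(i, j) (mvar R i ^+ shifted p j * (1 + (- beta) *: mvar R i) ^+ j).
  by apply/matrixP => i j; rewrite [LHS]mxE [RHS]mxE ffunE scaleNr.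
have E2 : \matrix_(i < N, j < N) (mvar R i ^+ part p j.+1
                             * (mvar R i - beta *: 1) ^+ (N - j.+1)) =
    \matrix_(i, j) (mvar R i ^+ (shifted p j - (N.-1 - j))
                     * (mvar R i + (- beta) *: 1) ^+ (N.-1 - j)).
  apply/matrixP => i j; rewrite [LHS]mxE [RHS]mxE ffunE scaleNr.
  by congr (_ ^+ _ * _ ^+ _); lia.
by rewrite /groth_poly /dual_groth_poly E1 E2.
Qed.

Lemma eval_scaled_alternant (c z : R) (l : {ffun 'I_N -> nat}) k :
  eval_at z (alternant_quotient
    (\matrix_(i < N, j < N) (mvar R i ^+ l j * (1 + c *: mvar R i) ^+ k))) =
  (1 + c * z) ^+ (k * N) * schur_at z l.
Proof.
set A := \matrix_(i, j) _.
rewrite (@alternant_quotientE _ _ A ((\prod_(i < N) (1 + c *: mvar R i)) ^+ k *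
    alternant_quotient (alternant R l))).
  rewrite /eval_at rmorphM rmorphXn rmorph_prod /=; congr (_ * _).
  under eq_bigr => i _ do rewrite rmorphD /= mpoly.mevalZ meval_mvar mpoly.meval1.
  by rewrite prodr_const card_ord -exprM mulnC.
rewrite -mulrA alternant_quotientK -[in LHS]det_tr -[in RHS]det_tr.
rewrite !det_columns -prodrXl mulr_sumr; apply: eq_bigr => s _.
rewrite mulrCA -big_split; congr (_ * _); apply: eq_bigr => j _.
by rewrite /A /alternant !mxE mulrC.
Qed.

(** When all particles are pinned on the last level, every column has the same number of lower
    factors; these leave the determinant, and a product of two Schur values remains. *)
Lemma schur_product x y beta p :
  eval_at x (alternant_quotient
    (\matrix_(i < N, j < N) (mvar R i ^+ shifted p j * (1 + (- beta) *: mvar R i) ^+ N.-1))) *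
  eval_at y (alternant_quotient
    (\matrix_(i < N, j < N) (mvar R i ^+ (shifted p j - (N.-1 - N.-1))
                     * (mvar R i + (- beta) *: 1) ^+ (N.-1 - N.-1)))) =
  (1 - beta * x) ^+ (N.-1 * N) * schur_at x (shifted p) * schur_at y (shifted p).
Proof.
rewrite eval_scaled_alternant mulNr; set B := \matrix_(i, j) _.
suff -> : B = alternant R (shifted p) by [].
by apply/matrixP => i j; rewrite !mxE subnn subn0 expr0 mulr1.
Qed.

(** Ties give the value 0 by antisymmetry. They arise when jumps are added to strictly decreasing
    exponents. *)
Lemma schur_at_weak_ge0 (z : R) (l : {ffun 'I_N -> nat}) : 0 < z ->
  (forall i j : 'I_N, (i < j)%N -> (l j <= l i)%N) -> 0 <= schur_at z l.
Proof.
move=> z0 lD; have [H|/existsNP[i /existsNP[j /not_implyP[ij /negP lij]]]] :=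
    pselect (forall i j : 'I_N, (i < j)%N -> (l j < l i)%N).
  exact: schur_at_ge0.
have lE : l i = l j by have := lD i j ij; move: lij; lia.
have ne : i != j by rewrite -val_eqE /=; lia.
have := schur_at_antisymmetric z l ne.
have -> : [ffun k => l (tperm i j k)] = l.
  by apply/ffunP => k; rewrite ffunE; case: tpermP => // ->.
lra.
Qed.

(* One term of the Pieri expansion of prod_i (1 + b z_i) s_l, all of whose terms
   are nonnegative. *)
Lemma pieri_le (z b : R) (l l' : {ffun 'I_N -> nat}) k : 0 < z -> 0 <= b ->
  (k <= N)%N ->
  (forall i j : 'I_N, (i < j)%N -> (l j < l i)%N) ->
  (forall j : 'I_N, l' j = (l j + (j < k))%N) ->
  b ^+ k * schur_at z l' <= (1 + b * z) ^+ N * schur_at z l.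
Proof.
move=> z0 b0 kN lD l'E.
have d1 : forall j : 'I_N, (1 <= 1)%N by [].
have := @eval_lower_alternant R N 1 l (fun=> 1%N) b z d1.
rewrite eval_scaled_alternant mul1n => ->.
have posE (e : {set 'I_1 * 'I_N}) j : position l (fun=> 1%N) e 0 j =
    (l j + ((ord0, j) \in e))%N.
  by rewrite ffunE /njumps !big_ord1 /= subn0.
(* The vertical strip with one box in each of the first [k] rows. *)
pose e0 : {set 'I_1 * 'I_N} := [set q : 'I_1 * 'I_N | (q.2 < k)%N]%SET.
have belowT (e : {set 'I_1 * 'I_N}) : e \subset below 1 (fun=> 1%N).
  by apply/fintype.subsetP => -[s j] _; rewrite inE /= ltn_ord.
rewrite (bigD1 e0 (belowT e0)) -[leLHS]addr0; apply: lerD.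
  have -> : #|e0| = k.
    rewrite card_columns /column_card exchange_big big_ord1 /=.
    under eq_bigr => j _ do rewrite inE /=.
    rewrite -[RHS]card_ord -sum1_card (big_ord_widen N (fun=> 1%N)) //.
    by rewrite [in RHS]big_mkcond.
  suff -> : position l (fun=> 1%N) e0 0 = l' by [].
  by apply/ffunP => j; rewrite posE l'E inE.
apply: sumr_ge0 => e _; rewrite mulr_ge0 ?exprn_ge0 //.
apply: schur_at_weak_ge0 => // i j ij; rewrite !posE.
by have := lD _ _ ij; case: (_ \in e); case: (_ \in e) => /=; lia.
Qed.

End Specialisations.

(** * Laws of discrete random variables *)

Section DiscreteLaws.
Variable R : realType.

(** Cuts [A] into pieces indexed by nat, each empty or a singleton, the form in which countable
    additivity applies. *)
Definition countable_fiber (I : countType) (A : set I) (k : nat) : set I :=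
  A `&` [set i | pickle i = k].

Lemma bigcup_countable_fiber (I : countType) (A : set I) :
  \bigcup_k countable_fiber A k = A.
Proof. by apply/seteqP; split => [i [k _ []]//|i Ai]; exists (pickle i). Qed.

Lemma countable_fiberP (I : countType) (A : set I) k :
  countable_fiber A k = set0 \/ exists2 i, A i & countable_fiber A k = [set i].
Proof.
have [E|/set0P[i [Ai ik]]] := eqVneq (countable_fiber A k) set0; [by left|right].
exists i => //; apply/seteqP; split => [j [_ jk]|_ ->//].
by apply: (pcan_inj (@pickleK I)); rewrite ik.
Qed.

Lemma measurable_preimage_points d (T : measurableType d) (I : countType) (X : T -> I) :
  (forall i, measurable (X @^-1` [set i])) -> forall A, measurable (X @^-1` A).
Proof.
move=> mX A; rewrite -(bigcup_countable_fiber A) preimage_bigcup.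
apply: bigcupT_measurable => k.
by have [->|[i _ ->]] := countable_fiberP A k; rewrite ?preimage_set0.
Qed.

(** Injectivity of [g] on [A] keeps the images of distinct points disjoint, so the pointwise bounds
    add up. The uses are [g = id] for comparing laws and column removal for the tail bound. *)
Lemma law_le d1 (T1 : measurableType d1) (P1 : probability T1 R)
    d2 (T2 : measurableType d2) (P2 : probability T2 R)
    (I J : countType) (X : T1 -> I) (Y : T2 -> J) (g : I -> J) (A : set I) (K : R) :
  (forall i, measurable (X @^-1` [set i])) ->
  (forall j, measurable (Y @^-1` [set j])) ->
  (forall i i', A i -> A i' -> g i = g i' -> i = i') -> 0 <= K ->
  (forall i, A i -> P1 (X @^-1` [set i]) <= K%:E * P2 (Y @^-1` [set g i]))%E ->
  (P1 (X @^-1` A) <= K%:E * P2 (Y @^-1` (g @` A)))%E.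
Proof.
move=> mX mY gI K0 PXY.
have mX' := measurable_preimage_points mX; have mY' := measurable_preimage_points mY.
have EX : X @^-1` A = \bigcup_k X @^-1` (countable_fiber A k).
  by rewrite -preimage_bigcup bigcup_countable_fiber.
have EY : Y @^-1` (g @` A) = \bigcup_k Y @^-1` (g @` countable_fiber A k).
  by rewrite -preimage_bigcup -image_bigcup bigcup_countable_fiber.
rewrite EX measure_semi_bigcup //; first last.
- exact: bigcupT_measurable.
- apply/trivIsetP => k k' _ _ kk'; apply/seteqP; split => // w [[_ /= wk] [_ /= wk']].
  by move/eqP: kk'; apply; exact: etrans (esym wk) wk'.
rewrite EY measure_semi_bigcup //; first last.
- exact: bigcupT_measurable.
- apply/trivIsetP => k k' _ _ kk'; apply/seteqP; split => //.
  move=> w [[i [Ai /= ik] giw] [i' [Ai' /= ik'] gi'w]].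
  move/eqP: kk'; apply; rewrite -ik -ik'; congr pickle.
  by apply: gI => //; rewrite giw.
rewrite -nneseriesZl //; apply: lee_nneseries => // k _.
have [->|[i Ai ->]] := countable_fiberP A k.
  by rewrite image_set0 !preimage_set0 !measure0 mule0.
by rewrite image_set1; exact: PXY.
Qed.

(* Both laws have total mass 1, so the proportionality factor k equals 1. *)
Lemma law_eq d1 (T1 : measurableType d1) (P1 : probability T1 R)
    d2 (T2 : measurableType d2) (P2 : probability T2 R)
    (I : countType) (X : T1 -> I) (Y : T2 -> I) (k : R) :
  (forall i, measurable (X @^-1` [set i])) ->
  (forall i, measurable (Y @^-1` [set i])) ->
  (forall i, P1 (X @^-1` [set i]) = k%:E * P2 (Y @^-1` [set i]))%E ->
  forall A, P1 (X @^-1` A) = P2 (Y @^-1` A).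
Proof.
move=> mX mY PXY.
have k1 : 1 <= k.
  (* The sign of [k] is still unknown, hence the maximum with 0. *)
  have : (P1 (X @^-1` setT) <= (Num.max k 0)%:E * P2 (Y @^-1` (id @` setT)))%E.
    apply: law_le => // [|i _]; first by rewrite le_max lexx orbT.
    by rewrite PXY lee_wpmul2r // lee_fin le_max lexx.
  rewrite image_id !preimage_setT !probability_setT mule1 lee_fin le_max.
  by case/orP => //; rewrite ler10.
have k0 : 0 < k by lra.
have PYX i : (P2 (Y @^-1` [set i]) = k^-1%:E * P1 (X @^-1` [set i]))%E.
  by rewrite PXY muleA -EFinM mulVf ?gt_eqF // mul1e.
have k2 : k = 1.
  have : (P2 (Y @^-1` setT) <= (k^-1)%:E * P1 (X @^-1` (id @` setT)))%E.
    by apply: law_le => // [|i _]; rewrite ?invr_ge0 ?PYX // ltW.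
  rewrite image_id !preimage_setT !probability_setT mule1 lee_fin => k1'.
  by apply/le_anti; rewrite k1 andbT -[leRHS]invr1 -[k]invrK lef_pV2 // ?posrE ?invr_gt0.
move=> A; apply/le_anti/andP; split.
  rewrite -{2}(image_id A) -[leRHS]mul1e; apply: law_le => // i _.
  by rewrite PXY k2.
rewrite -{2}(image_id A) -[leRHS]mul1e; apply: law_le => // i _.
by rewrite PXY k2 mul1e mul1e.
Qed.

Lemma law_null d (T : measurableType d) (P : probability T R)
    (I : countType) (X : T -> I) (A : set I) :
  (forall i, measurable (X @^-1` [set i])) ->
  (forall i, A i -> P (X @^-1` [set i]) = 0%E) -> P (X @^-1` A) = 0%E.
Proof.
move=> mX PX; apply/le_anti/andP; split; last exact: measure_ge0.
have := @law_le _ T P _ T P I I X X id A 0 mX mX; rewrite mul0e; apply => // i Ai.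
by rewrite PX // mul0e.
Qed.

(** Descriptions of events by the diagonal, by pinned chains and by heights agree only on strip
    chains; all other tuples are null. *)
Lemma law_eq_off_null d (T : measurableType d) (P : probability T R)
    (I : countType) (X : T -> I) (A B C : set I) :
  (forall i, measurable (X @^-1` [set i])) ->
  (forall i, ~ C i -> P (X @^-1` [set i]) = 0%E) ->
  A `&` C = B `&` C -> P (X @^-1` A) = P (X @^-1` B).
Proof.
move=> mX PX AB.
have mX' := measurable_preimage_points mX.
have E D : P (X @^-1` D) = P (X @^-1` (D `&` C)).
  rewrite -{1}(setUIDK D C) preimage_setU measureU //.
  - rewrite -[RHS]adde0; congr (_ + _)%E.
    by apply: law_null => // i [_ /PX].
  - by apply/seteqP; split => // w [[_ Cw] [_ /(_ Cw)]].
by rewrite (E A) (E B) AB.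
Qed.

Lemma law_finite_image d (T : measurableType d) (P : probability T R)
    (I : countType) (X : T -> I) (E : finType) (Q : pred E) (g : E -> I) :
  (forall i, measurable (X @^-1` [set i])) ->
  (forall e e', Q e -> Q e' -> g e = g e' -> e = e') ->
  (P (X @^-1` (g @` [set e | Q e])) = \sum_(e | Q e) P (X @^-1` [set g e]))%E.
Proof.
move=> mX gI; rewrite -(bigcup_imset1 [set e | Q e] g) preimage_bigcup.
rewrite measure_fin_bigcup //.
- rewrite -(bigfs _ (index_enum_uniq E)) // => i _; rewrite mem_index_enum //.
- exact: finite_finset.
- apply/trivIsetP => e e' Qe Qe' ee'; apply/seteqP; split => // w [/= we we'].
  by move/eqP: ee'; apply; apply: gI => //; rewrite -we.
Qed.

End DiscreteLaws.

(** * Marginals of the two measures *)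

Lemma card_initial_segment (N : nat) (Q : pred 'I_N) (j : 'I_N) :
  (forall i k : 'I_N, (i <= k)%N -> Q k -> Q i) ->
  (j < #|[set i | Q i]%SET|)%N = Q j.
Proof.
move=> QD.
have cardI k : (k <= N)%N -> #|[set i : 'I_N | (i < k)%N]%SET| = k.
  move=> kN; rewrite -[RHS]card_ord -!sum1_card [RHS](big_ord_widen N (fun=> 1%N)) //.
  by apply: eq_bigl => i; rewrite inE.
apply/idP/idP => [|Qj].
  apply: contraLR; rewrite -leqNgt => nQj.
  rewrite -[leqRHS](cardI j (ltnW (ltn_ord j))).
  apply/subset_leq_card/fintype.subsetP => i; rewrite !inE ltnNge => Qi.
  by apply: contra nQj => ji; exact: QD ji Qi.
rewrite -{1}(cardI j.+1 (ltn_ord j)); apply/subset_leq_card/fintype.subsetP => i.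
by rewrite !inE ltnS => ij; exact: QD ij Qj.
Qed.

Section Diagonal.
Variable N : nat.
Implicit Types (m : N.-tuple (npartition N)).

Definition diagonal m : npartition N := mkpart (fun j : 'I_N => part (level m j.+1) j.+1).

(** With b = a + 1, the strip condition and the order of parts give mu^b_b <= mu^a_b <= mu^a_a, so
    [mkpart] does not fall back to its default. *)
Lemma part_diagonal m (j : 'I_N) : strip_chain m ->
  part (diagonal m) j.+1 = part (level m j.+1) j.+1.
Proof.
move=> sm; rewrite mkpartE // => a b ba.
have aN : (a < N.-1)%N by have := ltn_ord b; lia.
have /forallP/(_ b) := sm (Ordinal aN); rewrite /= ba => ab.
apply: (@leq_trans (part (level m a.+1) b.+1)); first by move: ab; rewrite ba; lia.
by apply: part_mono; rewrite ba.
Qed.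

Lemma leq_height m a t k : (0 < k <= N)%N ->
  (k <= height m a t)%N = (a <= part (level m t) k + (N - k))%N.
Proof.
case: k => // k kN; pose Q (j : 'I_N) := (a <= shifted (level m t) j)%N.
have -> : height m a t = #|[set j : 'I_N | Q j]%SET|.
  by apply: eq_card => j; rewrite !inE /Q ffunE.
rewrite (@card_initial_segment N Q (Ordinal kN)) /Q ?ffunE // => i j ij.
move=> /leq_trans; apply; rewrite !ffunE.
by have := part_mono (level m t) ij; lia.
Qed.

End Diagonal.

Section ProcessLaws.
Variables (R : realType) (x y beta : R) (N : nat).
Hypothesis N_gt0 : (0 < N)%N.
Variables (dS : measure_display) (TS : measurableType dS) (PS : probability TS R).
Variable (mu : TS -> N.-tuple (npartition N)).
Hypothesis muP : is_schur_process x y beta PS mu.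

Lemma measurable_process m : measurable (mu @^-1` [set m]).
Proof. by have [c /(_ m)[]] := muP. Qed.

Lemma process_not_strip m : ~ strip_chain m -> PS (mu @^-1` [set m]) = 0%E.
Proof. by move=> sm; have [c /(_ m)[_ ->]] := muP; rewrite weight_not_strip ?mulr0. Qed.

Lemma pinned_law (delta : 'I_N -> nat) :
  (forall j, (delta j <= N.-1)%N) -> (forall j : 'I_N, (j <= delta j)%N) ->
  (forall a b : 'I_N, b = a.+1 :> nat -> (delta a <= delta b <= (delta a).+1)%N) ->
  exists c : R, forall p, PS (mu @^-1` pinned_chains delta p) = (c *
  (eval_at x (alternant_quotient
    (\matrix_(i, j) (mvar R i ^+ shifted p j * (1 + (- beta) *: mvar R i) ^+ delta j))) *
  eval_at y (alternant_quotient
    (\matrix_(i, j) (mvar R i ^+ (shifted p j - (N.-1 - delta j))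
                     * (mvar R i + (- beta) *: 1) ^+ (N.-1 - delta j))))))%:E.
Proof.
move=> dn dge dS'; have [c cP] := muP; exists c => p.
rewrite -(sum_strict_weight N_gt0 dn dge dS') mulr_sumr -sumEFin.
rewrite (pinned_chainsE N_gt0 dn dge) law_finite_image.
- by apply: eq_bigr => e _; have [] := cP (chain_of delta p e).
- exact: measurable_process.
- by move=> e e'; exact: (chain_of_inj N_gt0 dge).
Qed.

Lemma schur_marginal_law : exists c : R, forall p,
  PS ((fun w => level (mu w) N) @^-1` [set p]) =
  (c * (schur_at x (shifted p) * schur_at y (shifted p)))%:E.
Proof.
have [||| c cP] := @pinned_law (fun=> N.-1) => //; first by move=> j; have := ltn_ord j; lia.
  by move=> a b _; rewrite leqnn leqnSn.
exists (c * (1 - beta * x) ^+ (N.-1 * N)) => p.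
have cpE : PS (mu @^-1` pinned_chains (fun=> N.-1) p) =
    (c * ((1 - beta * x) ^+ (N.-1 * N) * schur_at x (shifted p) * schur_at y (shifted p)))%:E.
  by rewrite -schur_product; exact: cP.
have -> : c * (1 - beta * x) ^+ (N.-1 * N) *
    (schur_at x (shifted p) * schur_at y (shifted p)) =
  c * ((1 - beta * x) ^+ (N.-1 * N) * schur_at x (shifted p) * schur_at y (shifted p)).
  by rewrite -!mulrA.
rewrite -cpE.
apply: (@law_eq_off_null _ _ _ PS _ mu ((fun m => level m N) @^-1` [set p]) _ (@strip_chain N)).
- exact: measurable_process.
- exact: process_not_strip.
apply/seteqP; split => m [/= mp sm]; split => //.
  by split => // j; rewrite prednK // mp.
by apply: npartition_ext => j; have [_ /(_ j)] := mp; rewrite prednK.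
Qed.

Section Comparison.
Hypotheses (xy_lt1 : x * y < 1) (x_gt0 : 0 < x) (beta_lt0 : beta < 0).
Variables (dG : measure_display) (TG : measurableType dG) (PG : probability TG R).
Variable (lam : TG -> npartition N).
Hypothesis lamP : is_grothendieck x y beta PG lam.

Lemma grothendieck_diagonal_law B :
  PG (lam @^-1` B) = PS ((fun w => diagonal (mu w)) @^-1` B).
Proof.
have [||| c cP] := @pinned_law (@nat_of_ord N) => //; first by move=> j; have := ltn_ord j; lia.
  by move=> a b ->; rewrite leqnn leqnSn.
(* Dividing by this nonzero prefactor of [groth_prob] makes the two laws proportional with the
   factor [c / K]. *)
pose K := (1 - x * y) ^+ (N ^ 2) / (1 - x * beta) ^+ (N * N.-1).
have xb : x * beta < 0 by rewrite pmulr_rlt0.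
have K0 : K != 0.
  have h1 : 1 - x * y != 0 by apply/eqP; move: xy_lt1; lra.
  have h2 : 1 - x * beta != 0 by apply/eqP; move: xb; lra.
  by rewrite mulf_neq0 ?invr_neq0 ?expf_neq0.
symmetry; apply: (@law_eq _ _ _ _ _ _ _ _ _ _ (c / K)) => [p|p|p].
- exact: (measurable_preimage_points measurable_process [set m | diagonal m = p]).
- by have [] := lamP p.
have KE u : c / K * (K * u) = c * u by rewrite mulrA divfK.
have [_ ->] := lamP p; rewrite -EFinM /groth_prob -mulrA KE groth_product -cP.
apply: (@law_eq_off_null _ _ _ PS _ mu ((@diagonal N) @^-1` [set p]) _ (@strip_chain N)).
- exact: measurable_process.
- exact: process_not_strip.
apply/seteqP; split => m [/= mp sm]; split => //.
  by split => // j; rewrite -part_diagonal // mp.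
by apply: npartition_ext => j; rewrite part_diagonal //; have [_] := mp.
Qed.

Lemma grothendieck_height_law a t : (0 < t <= N)%N ->
  PG [set w | (a <= part (lam w) t + (N - t))%N] =
  PS [set w | (t <= height (mu w) a t)%N].
Proof.
move=> tN; have := grothendieck_diagonal_law [set p | (a <= part p t + (N - t))%N].
move=> ->.
apply: (@law_eq_off_null _ _ _ PS _ mu
  ((@diagonal N) @^-1` [set p | (a <= part p t + (N - t))%N])
  [set m | (t <= height m a t)%N] (@strip_chain N)).
- exact: measurable_process.
- exact: process_not_strip.
have E (m : N.-tuple (npartition N)) : strip_chain m -> part (diagonal m) t = part (level m t) t.
  by case: t tN => // t /andP[_ tN] sm; exact: (part_diagonal (Ordinal tN) sm).
by apply/seteqP; split => m [/= h sm]; split => //=; move: h; rewrite leq_height // E.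
Qed.

End Comparison.

(** * The number of nonempty rows of the last level *)

Definition nrows (p : npartition N) : nat := #|[set j : 'I_N | (0 < part p j.+1)%N]%SET|.

Lemma nrowsP p (j : 'I_N) : (0 < part p j.+1)%N = (j < nrows p)%N.
Proof.
rewrite (@card_initial_segment _ (fun j : 'I_N => 0 < part p j.+1)%N) //.
by move=> i k ik /leq_trans; apply; exact: part_mono.
Qed.

Lemma nrows_le p : (nrows p <= N)%N.
Proof. by rewrite -[leqRHS]card_ord max_card. Qed.

Definition remove_column (p : npartition N) : npartition N :=
  mkpart (fun j => (part p j.+1).-1).

Lemma part_remove_column p (j : 'I_N) :
  part p j.+1 = (part (remove_column p) j.+1 + (j < nrows p))%N.
Proof.
rewrite /remove_column mkpartE; last first.
  by move=> a b ba; have := @part_mono N p a b; rewrite ba; lia.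
by rewrite -nrowsP; lia.
Qed.

Lemma schur_remove_column (z b : R) p : 0 < z -> 0 <= b ->
  b ^+ nrows p * schur_at z (shifted p) <=
  (1 + b * z) ^+ N * schur_at z (shifted (remove_column p)).
Proof.
move=> z0 b0; apply: pieri_le => //.
- exact: nrows_le.
- by move=> i j; exact: shifted_lt.
- by move=> j; rewrite !ffunE part_remove_column; lia.
Qed.

Section RowBound.
Hypotheses (x_gt0 : 0 < x) (y_gt0 : 0 < y).

(** The Pieri bounds in x and in y compare the Schur weight of a partition with that of the
    partition without its first column. Once the number k of rows is known, this removal is
    injective, so the image has total mass at most 1. *)
Lemma nrows_law_le (b : R) k : 1 <= b ->
  (PS [set w | nrows (level (mu w) N) = k] <=
   (((1 + b * x) ^+ N * (1 + b * y) ^+ N) / (b * b) ^+ k)%:E)%E.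
Proof.
move=> b1; have b0 : 0 < b by lra.
have [c cP] := schur_marginal_law.
have mlast := measurable_preimage_points measurable_process.
pose last w := level (mu w) N.
have ml p : measurable (last @^-1` [set p]) by exact: (mlast [set m | level m N = p]).
have S0 p z : 0 < z -> 0 <= schur_at z (shifted p).
  by move=> z0; apply: schur_at_ge0 => // i j; exact: shifted_lt.
(* A negative [c] would make every point mass nonpositive, contradicting total mass 1. *)
have c0 : 0 <= c.
  rewrite leNgt; apply/negP => c_lt0.
  suff : (PS (last @^-1` setT) <= 0%:E * PS (last @^-1` (id @` setT)))%E.
    by rewrite preimage_setT probability_setT mul0e lee_fin ler10.
  apply: law_le => // p _; rewrite mul0e cP lee_fin.
  by rewrite nmulr_rle0 // mulr_ge0 // S0.
set K := _ / _.
have K0 : 0 <= K.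
  by rewrite divr_ge0 ?mulr_ge0 ?exprn_ge0 ?mulr_ge0 ?addr_ge0 ?mulr_ge0 // ltW.
have := @law_le _ _ _ PS _ _ PS _ _ last last remove_column [set p | nrows p = k] K ml ml.
move=> H; apply: (@le_trans _ _ (K%:E * PS (last @^-1` (remove_column @` [set p | nrows p = k])))%E).
  apply: H => // [p q /= pk qk pq|p /= pk].
    by apply: npartition_ext => j; rewrite part_remove_column [RHS]part_remove_column pq pk qk.
  rewrite !cP -EFinM lee_fin [leRHS]mulrCA ler_wpM2l // /K.
  rewrite mulrAC ler_pdivlMr ?exprn_gt0 ?mulr_gt0 //.
  have := schur_remove_column p x_gt0 (ltW b0); have := schur_remove_column p y_gt0 (ltW b0).
  rewrite pk => hy hx.
  have Sxy := ler_pM _ _ hx hy.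
  rewrite exprMn [leLHS]mulrACA [leRHS]mulrACA.
  rewrite [X in X * _ <= _]mulrC [X in _ * X <= _]mulrC.
  apply: Sxy; apply: mulr_ge0; [|exact: S0| |exact: S0]; exact/exprn_ge0/ltW.
rewrite -[leRHS]mule1; apply: lee_wpmul2l; rewrite ?lee_fin //.
apply: probability_le1.
exact: (measurable_preimage_points ml).
Qed.

(** A union bound over the number of rows; since [1 <= b], the bound for exactly i >= k rows is
    largest at i = k. *)
Lemma row_law_le (b : R) k : 1 <= b -> (0 < k <= N)%N ->
  (PS [set w | (0 < part (level (mu w) N) k)%N] <=
   (N.+1%:R * (((1 + b * x) ^+ N * (1 + b * y) ^+ N) / (b * b) ^+ k))%:E)%E.
Proof.
move=> b1 /andP[k0 kN].
have mmu := measurable_preimage_points measurable_process.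
have b0 : 0 < b by lra.
set M := (1 + b * x) ^+ N * (1 + b * y) ^+ N.
have M0 : 0 <= M.
  by rewrite mulr_ge0 // exprn_ge0 // addr_ge0 // mulr_ge0 // ltW.
pose F i : set TS := if (k <= i)%N then [set w | nrows (level (mu w) N) = i] else set0.
have mF i : measurable (F i).
  by rewrite /F; case: ifP => // _; exact: (mmu [set m | nrows (level m N) = i]).
have rowsE p : (0 < part p k)%N = (k <= nrows p)%N.
  by case: k k0 kN {F mF} => // k _ kN; exact: (nrowsP p (Ordinal kN)).
have -> : [set w | (0 < part (level (mu w) N) k)%N] = \big[setU/set0]_(i < N.+1) F i.
  rewrite -bigcup_mkord; apply/seteqP; split => [w /=|w [i _]].
    rewrite rowsE => h; exists (nrows (level (mu w) N)); first by rewrite /= ltnS nrows_le.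
    by rewrite /F h.
  by rewrite /F; case: ifP => //= ki Ei; rewrite rowsE Ei.
apply: le_trans (Boole_inequality PS (A := F) (n := N.+1) (fun i _ => mF i)) _.
apply: (@le_trans _ _ (\sum_(i < N.+1) (M / (b * b) ^+ k)%:E)%E).
  apply: lee_sum => i _; rewrite /F; case: ifP => ki; last first.
    by rewrite measure0 lee_fin divr_ge0 // exprn_ge0 // mulr_ge0 // ltW.
  apply: le_trans (nrows_law_le _ b1) _; rewrite lee_fin.
  rewrite ler_wpM2l // lef_pV2 ?posrE ?exprn_gt0 ?mulr_gt0 //.
  by rewrite ler_weXn2l // mulr_ege1.
by rewrite sumEFin lee_fin sumr_const card_ord mulr_natl.
Qed.

End RowBound.
End ProcessLaws.

(** * Limits *)

Lemma bernoulli_ineq (R : numDomainType) (u : R) n :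
  0 <= u -> 1 + n%:R * u <= (1 + u) ^+ n.
Proof.
move=> u0; elim: n => [|n IH]; first by rewrite mul0r addr0.
rewrite exprS; apply: (@le_trans _ _ ((1 + u) * (1 + n%:R * u))); last first.
  by rewrite ler_wpM2l // addr_ge0.
have -> : (1 + u) * (1 + n%:R * u) = 1 + n.+1%:R * u + n%:R * (u * u).
  by rewrite -natr1; ring.
by rewrite lerDl !mulr_ge0.
Qed.

Lemma expr_unbounded (R : realType) (s M : R) : 1 < s -> exists q, M <= s ^+ q.
Proof.
move=> s1; have s0 : 0 < s - 1 by lra.
pose n := (Num.truncn (`|M| / (s - 1))).+1; exists n; apply: le_trans (ler_norm M) _.
have : `|M| / (s - 1) < n%:R.
  by have /andP[] := truncn_itv (divr_ge0 (normr_ge0 M) (ltW s0)).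
rewrite ltr_pdivrMr // => Mn; have := bernoulli_ineq n (ltW s0).
have -> : 1 + (s - 1) = s by lra.
by lra.
Qed.

Lemma cvg_natr_mul_expr (R : realType) (r : R) : 0 <= r < 1 ->
  (fun n => n.+1%:R * r ^+ n) @ \oo --> 0.
Proof.
move=> /andP[r0 r1].
have [->|rn0] := eqVneq r 0.
  apply: (@cvg_trans _ ((fun=> 0 : R) @ \oo)); last exact: cvg_cst.
  apply: near_eq_cvg; near=> n; rewrite expr0n.
  have n0 : (0 < n)%N by near: n; exact: nbhs_infty_gt.
  by rewrite gtn_eqF // mulr0.
have {rn0}r0 : 0 < r by rewrite lt_def rn0.
(* Chosen so that (1 + u) r = (1 + r) / 2 is still below 1, while (1 + u)^n absorbs the linear
   factor by Bernoulli, up to the constant [C]. *)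
pose u := ((1 + r) / 2) / r - 1.
have u0 : 0 < u by rewrite subr_gt0 ltr_pdivlMr //; lra.
have ur : (1 + u) * r = (1 + r) / 2 by rewrite /u addrC subrK divfK // gt_eqF.
have q1 : `|(1 + r) / 2| < 1 by rewrite ger0_norm; lra.
pose C := 1 + u^-1.
have C0 : 0 < C by rewrite addr_gt0 ?invr_gt0.
apply: (@squeeze_cvgr _ _ _ _ (fun=> 0) (fun n => C * ((1 + r) / 2) ^+ n)).
- apply: nearW => n; apply/andP; split => /=.
    by rewrite mulr_ge0 // exprn_ge0 // ltW.
  rewrite -ur exprMn mulrA; apply: ler_wpM2r; first by rewrite exprn_ge0 // ltW.
  have := bernoulli_ineq n (ltW u0) => B.
  apply: (@le_trans _ _ (C * (1 + n%:R * u))); last by rewrite ler_wpM2l // ltW.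
  have -> : C * (1 + n%:R * u) = 1 + u^-1 + n%:R * u + n%:R.
    by rewrite /C; field; rewrite gt_eqF.
  rewrite -natr1.
  have : 0 <= u^-1 by rewrite invr_ge0 ltW.
  have : 0 <= n%:R * u by rewrite mulr_ge0 // ltW.
  by lra.
- exact: cvg_cst.
- rewrite -[X in _ --> X](mulr0 C); apply: cvgMr; exact: cvg_expr.
Unshelve. all: by end_near. Qed.

Lemma cvge0_le (R : realType) (u v : nat -> \bar R) :
  (\forall n \near \oo, 0 <= u n <= v n)%E -> v @ \oo --> 0%E -> u @ \oo --> 0%E.
Proof. by move=> uv v0; exact: (squeeze_cvge uv (cvg_cst _) v0). Qed.

Lemma truncn_scale_bounds (R : realType) (z : R) N : 0 <= z ->
  z * N%:R - 1 < (Num.truncn (z * N%:R))%:R <= z * N%:R.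
Proof.
move=> z0; have /andP[h1 h2] := truncn_itv (mulr_ge0 z0 (ler0n R N)).
by rewrite h1 andbT; move: h2; rewrite -natr1; lra.
Qed.

(** * The sign of [h xi tau - tau] on either side of [L] *)

Section DiagonalSection.
Variables (R : realType) (h : R -> R -> R) (L : R -> R).
Hypothesis h_xi : forall xi xi' tau, 0 <= xi <= xi' -> 0 <= tau <= 1 ->
  h xi' tau <= h xi tau.
Hypothesis h_tau : forall xi tau tau', 0 <= xi -> 0 <= tau -> tau <= tau' <= 1 ->
  h xi tau' <= h xi tau.
Hypothesis L_ge0 : forall t, 0 <= t <= 1 -> 0 <= L t.
Hypothesis L_cont : {within `[0, 1], continuous L}.
Hypothesis LP : forall t, 0 <= t <= 1 -> h (L t) t = t.

Lemma section_value (a b xi : R) : 0 <= a -> a <= b -> b <= 1 ->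
  L b <= xi <= L a -> exists2 s, a <= s <= b & L s = xi.
Proof.
move=> a0 ab b1 xiP.
have Lc : {within `[a, b], continuous L}.
  apply: continuous_subspaceW L_cont => s /=; rewrite !in_itv /=; lra.
have [|s] := IVT (v := xi) ab Lc.
  have /andP[h1 h2] := xiP; have h3 := le_trans h1 h2.
  by rewrite minEle maxEle; case: ifP => h4; apply/andP; split=> //; lra.
by rewrite in_itv /= => sab Ls; exists s.
Qed.

Lemma height_above_section tau xi : 0 < tau <= 1 -> L tau < xi -> h xi tau < tau.
Proof.
move=> tau01 Lxi; have L0 : 0 <= L tau by apply: L_ge0; lra.
have [xiL|Lxi0] := leP xi (L 0).
  (* xi = L s with s < tau, so h xi tau <= h xi s = s < tau *)
  have [||||s s01 Ls] := @section_value 0 tau xi; try lra.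
  have sne : s != tau by apply: contraTneq Lxi => <-; rewrite -Ls ltxx.
  have slt : s < tau by rewrite lt_neqAle sne; lra.
  have hs : h (L s) s = s by apply: LP; lra.
  by have := @h_tau xi s tau; rewrite -Ls hs; lra.
(* Beyond [L 0], monotonicity in both variables compares with h (L 0) 0 = 0. *)
have L00 : 0 <= L 0 by apply: L_ge0; lra.
have h1 : h xi tau <= h xi 0 by apply: h_tau; lra.
have h2 : h xi 0 <= h (L 0) 0 by apply: h_xi; lra.
have h3 : h (L 0) 0 = 0 by apply: LP; lra.
by lra.
Qed.

Lemma height_below_section tau xi : 0 < tau < 1 -> 0 <= xi < L tau -> tau < h xi tau.
Proof.
move=> tau01 Lxi.
have [Lxi1|xiL1] := leP (L 1) xi.
  have [||||s s01 Ls] := @section_value tau 1 xi; try lra.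
  have sne : tau != s.
    by apply/eqP => ts; move: Lxi; rewrite -Ls ts; lra.
  have slt : tau < s by rewrite lt_neqAle sne; lra.
  have hs : h (L s) s = s by apply: LP; lra.
  by have := @h_tau xi tau s; rewrite -Ls hs; lra.
(* Below [L 1], monotonicity compares with h (L 1) 1 = 1 > tau. *)
have h1 : h xi 1 <= h xi tau by apply: h_tau; lra.
have h2 : h (L 1) 1 <= h xi 1 by apply: h_xi; lra.
have h3 : h (L 1) 1 = 1 by apply: LP; lra.
by lra.
Qed.

End DiagonalSection.

Section HeightConvergence.
Variables (R : realType) (x y beta : R).
Variables (dS : nat -> measure_display) (TS : forall N, measurableType (dS N))
  (PS : forall N, probability (TS N) R)
  (mu : forall N, TS N -> N.-tuple (npartition N)).
Hypothesis muP : forall N, is_schur_process x y beta (PS N) (@mu N).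
Variables (h : R -> R -> R).
Hypothesis hP : is_limit_shape PS (@mu) h.

Let msets N := measurable_preimage_points (measurable_process (muP N)).

(** The threshold [k] is general because it is [t N] on the diagonal but [N - N %/ q] in the bottom
    row argument. *)
Lemma height_lt_cvg0 (xi tau c : R) (k : nat -> nat) :
  0 <= xi -> 0 < tau <= 1 -> c < h xi tau ->
  (\forall N \near \oo, (k N)%:R <= c * N%:R) ->
  (fun N => PS N [set w | (height (mu w) (Num.truncn (xi * N%:R))
                            (Num.truncn (tau * N%:R)) < k N)%N]) @ \oo --> 0%E.
Proof.
move=> xi0 tau01 ch kc; have [_ _ _ _ H] := hP.
have d0 : 0 < h xi tau - c by lra.
apply: cvge0_le (H xi tau xi0 tau01 _ d0).
near=> N; rewrite measure_ge0 /=; apply: le_measure; rewrite ?inE.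
- exact: (msets [set m | (height m (Num.truncn (xi * N%:R)) (Num.truncn (tau * N%:R)) < k N)%N]).
- exact: (msets [set m | h xi tau - c <= `|(height m (Num.truncn (xi * N%:R))
    (Num.truncn (tau * N%:R)))%:R / N%:R - h xi tau|]).
move=> w /=; rewrite -(ltr_nat R) => Hk.
have kN : (k N)%:R <= c * N%:R by near: N.
have N0 : 0 < N%:R :> R by rewrite ltr0n; near: N; exact: nbhs_infty_gt.
rewrite distrC ler_normr; apply/orP; left.
suff : (height (mu w) (Num.truncn (xi * N%:R)) (Num.truncn (tau * N%:R)))%:R / N%:R <= c by lra.
by rewrite ler_pdivrMr //; lra.
Unshelve. all: by end_near. Qed.

Lemma height_ge_cvg0 (xi tau c : R) (k : nat -> nat) :
  0 <= xi -> 0 < tau <= 1 -> h xi tau < c ->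
  (\forall N \near \oo, c * N%:R <= (k N)%:R) ->
  (fun N => PS N [set w | (k N <= height (mu w) (Num.truncn (xi * N%:R))
                            (Num.truncn (tau * N%:R)))%N]) @ \oo --> 0%E.
Proof.
move=> xi0 tau01 ch kc; have [_ _ _ _ H] := hP.
have d0 : 0 < c - h xi tau by lra.
apply: cvge0_le (H xi tau xi0 tau01 _ d0).
near=> N; rewrite measure_ge0 /=; apply: le_measure; rewrite ?inE.
- exact: (msets [set m | (k N <= height m (Num.truncn (xi * N%:R)) (Num.truncn (tau * N%:R)))%N]).
- exact: (msets [set m | c - h xi tau <= `|(height m (Num.truncn (xi * N%:R))
    (Num.truncn (tau * N%:R)))%:R / N%:R - h xi tau|]).
move=> w /=; rewrite -(ler_nat R) => Hk.
have kN : c * N%:R <= (k N)%:R by near: N.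
have N0 : 0 < N%:R :> R by rewrite ltr0n; near: N; exact: nbhs_infty_gt.
rewrite ler_normr; apply/orP; left.
suff : c <= (height (mu w) (Num.truncn (xi * N%:R)) (Num.truncn (tau * N%:R)))%:R / N%:R by lra.
by rewrite ler_pdivlMr //; lra.
Unshelve. all: by end_near. Qed.

End HeightConvergence.

Lemma near_natr_mul_ge (R : realType) (d r : R) : 0 < d ->
  \forall N \near \oo, r <= d * N%:R.
Proof.
move=> d0; near=> N; rewrite mulrC -ler_pdivrMr // ltW //.
by near: N; exact: nbhs_infty_gtr.
Unshelve. all: by end_near. Qed.

(* As b grows, (1 + b x)(1 + b y) / b^2 tends to x y < 1. *)
Lemma row_bound_cvg0 (R : realType) (x y : R) : 0 < x -> 0 < y -> x * y < 1 ->
  exists2 b : R, 1 <= b & exists q0 : nat, forall q, (q0 <= q)%N ->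
  (fun N => N.+1%:R * (((1 + b * x) ^+ N * (1 + b * y) ^+ N) /
     (b * b) ^+ (N - N %/ q))) @ \oo --> 0.
Proof.
move=> x0 y0 xy1.
(* With this [b], the difference (1 + b x)(1 + b y) - b^2 equals 1 - b, which is negative. *)
pose b := (1 + x + y) / (1 - x * y).
have xy0 : 0 < x * y by rewrite mulr_gt0.
have b1 : 1 < b by rewrite ltr_pdivlMr; lra.
have b0 : 0 < b by lra.
have bE : b * (1 - x * y) = 1 + x + y by rewrite divfK // gt_eqF; lra.
clearbody b.
pose rho0 := ((1 + b * x) * (1 + b * y)) / (b * b).
have bx : 0 < 1 + b * x by rewrite addr_gt0 // mulr_gt0.
have by_ : 0 < 1 + b * y by rewrite addr_gt0 // mulr_gt0.
have bb : 0 < b * b by rewrite mulr_gt0.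
have r0 : 0 < rho0 by rewrite divr_gt0 // mulr_gt0.
have r1 : rho0 < 1.
  rewrite ltr_pdivrMr // mul1r.
  have : b * (b * (1 - x * y)) = b * (1 + x + y) by rewrite bE.
  by lra.
(* A base between 1 and 1 / rho0. Once b^2 <= s^q, the loss (b^2)^(N/q) from using fewer than N rows
   is at most s^N, and (rho0 s)^N still decays geometrically. *)
pose s := (1 + rho0^-1) / 2.
have s1 : 1 < s.
  have ri : 1 < rho0^-1 by rewrite invf_gt1.
  by rewrite /s; lra.
have rsE : rho0 * s = (1 + rho0) / 2 by rewrite /s; field; rewrite gt_eqF.
have [q0 bq0] := expr_unbounded (b * b) s1.
exists b; first exact: ltW.
exists q0 => q q0q.
have H : (fun n => n.+1%:R * (rho0 * s) ^+ n) @ \oo --> 0.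
  by apply: cvg_natr_mul_expr; rewrite rsE; lra.
apply: (@squeeze_cvgr _ _ _ _ (fun=> 0) (fun n => n.+1%:R * (rho0 * s) ^+ n));
  [| exact: cvg_cst | exact: H].
apply: nearW => N; apply/andP; split.
  by rewrite mulr_ge0 // divr_ge0 // ?mulr_ge0 // exprn_ge0 // ltW.
apply: ler_wpM2l => //; rewrite ler_pdivrMr ?exprn_gt0 //.
have -> : (1 + b * x) ^+ N * (1 + b * y) ^+ N = rho0 ^+ N * (b * b) ^+ N.
  by rewrite -!exprMn /rho0 divfK // gt_eqF.
have divN : (N %/ q <= N)%N by exact: leq_div.
have -> : (b * b) ^+ N = (b * b) ^+ (N - N %/ q) * (b * b) ^+ (N %/ q).
  by rewrite -exprD subnK.
rewrite [(rho0 * s) ^+ N]exprMn -[leRHS]mulrA.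
apply: ler_wpM2l; first by rewrite exprn_ge0 // ltW.
rewrite mulrC; apply: ler_wpM2r; first by rewrite exprn_ge0 // ltW.
have sq : b * b <= s ^+ q by apply: le_trans bq0 _; rewrite ler_weXn2l // ltW.
apply: (@le_trans _ _ ((s ^+ q) ^+ (N %/ q))).
  by apply: lerXn2r sq; rewrite nnegrE ?exprn_ge0 ?ltW //; lra.
by rewrite -exprM ler_weXn2l ?ltW // mulnC leq_trunc_div.
Qed.

Section BottomRow.
Variables (R : realType) (x y beta : R).
Hypotheses (x_gt0 : 0 < x) (y_gt0 : 0 < y) (xy_lt1 : x * y < 1).
Variables (dS : nat -> measure_display) (TS : forall N, measurableType (dS N))
  (PS : forall N, probability (TS N) R)
  (mu : forall N, TS N -> N.-tuple (npartition N)).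
Hypothesis muP : forall N, is_schur_process x y beta (PS N) (@mu N).
Variables (h : R -> R -> R).
Hypothesis hP : is_limit_shape PS (@mu) h.

(* A positive fraction of the rows of mu^N is empty, so the bottom particles
   of the last level are packed. *)
Lemma limit_shape_last_lt1 xi : 0 < xi -> h xi 1 < 1.
Proof.
move=> xi0; rewrite ltNge; apply/negP => h1.
have [b b1 [q0 Hb]] := row_bound_cvg0 x_gt0 y_gt0 xy_lt1.
(* Besides [q0 <= q] this ensures 2 <= xi q, so that N/q + 1 <= xi N as soon as q <= N. *)
pose q := (q0 + (Num.truncn (2 / xi)).+2)%N.
have q0q : (q0 <= q)%N by rewrite leq_addr.
have q2 : (1 < q)%N by rewrite /q; lia.
have qR : 0 < q%:R :> R by rewrite ltr0n; lia.
have qxi : 2 <= xi * q%:R.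
  rewrite mulrC -ler_pdivrMr //.
  have /andP[_] := truncn_itv (ltW (divr_gt0 (ltr0Sn R 1) xi0)).
  move=> /ltW /le_trans; apply; rewrite ler_nat /q.
  by rewrite (leq_trans (leqnSn _)) // leq_addl.
pose k N := (N - N %/ q)%N.
(* Half of the fraction 1/q pays for the rounding in [N %/ q], and [c] stays strictly below 1. *)
pose c : R := 1 - (2 * q%:R)^-1.
have c1 : c < 1 by rewrite /c ltrBlDr ltrDl invr_gt0 mulr_gt0.
have kc : \forall N \near \oo, (k N)%:R <= c * N%:R.
  near=> N; rewrite natrB ?leq_div // /c mulrBl mul1r lerD2l lerN2.
  have N2 : 2 * q%:R <= N%:R :> R by near: N; exact: nbhs_infty_ger.
  have : (N%:R : R) < (N %/ q).+1%:R * q%:R.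
    by rewrite -natrM ltr_nat; apply: ltn_ceil; exact: ltnW.
  rewrite -natr1 => hN.
  rewrite [leLHS]mulrC ler_pdivrMr ?mulr_gt0 //.
  set d := (N %/ q)%:R in hN *; have : d * (2 * q%:R) = 2 * ((d + 1) * q%:R) - 2 * q%:R by ring.
  by lra.
have xi01 : 0 <= xi by exact: ltW.
have t01 : (0 : R) < 1 <= (1 : R) by rewrite ltr01 lexx.
have A1 := height_lt_cvg0 muP hP xi01 t01 (lt_le_trans c1 h1) kc.
have A2 : (fun N => (N.+1%:R * (((1 + b * x) ^+ N * (1 + b * y) ^+ N) /
     (b * b) ^+ (N - N %/ q)))%:E) @ \oo --> (0 : R)%:E.
  by apply: cvg_EFin; [exact: nearW | exact: Hb].
have A12 := cvgeD (isT : ((0 : \bar R) +? (0%R : R)%:E)%E) A1 A2.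
(* Either row [k N] is nonempty, or its particle sits at [N %/ q], below the truncation of xi N, so
   that the height is less than [k N]. These two events cover the space, yet both probabilities tend
   to 0. *)
have : (fun=> 1%E : \bar R) @ \oo --> (0%E : \bar R).
  rewrite adde0 in A12; apply: (cvge0_le _ (A12 _)); near=> N.
  rewrite lee01 /=.
  have N0 : (0 < N)%N by near: N; exact: nbhs_infty_gt.
  have kN : (0 < k N <= N)%N by rewrite /k leq_subr subn_gt0 ltn_Pdiv.
  apply: le_trans (leeD2l _ (row_law_le N0 (muP N) x_gt0 y_gt0 b1 kN)).
  have mS := measurable_preimage_points (measurable_process (muP N)).
  rewrite -(probability_setT (PS N)).
  set A := [set w | (_ < k N)%N]; set B := [set w | _].
  have mA : measurable A.
    exact: (mS [set m | (height m (Num.truncn (xi * N%:R)) (Num.truncn (1 * N%:R : R)) < k N)%N]).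
  have mB : measurable B by exact: (mS [set m | (0 < part (level m N) (k N))%N]).
  apply: le_trans (measureU2 _ mA mB); apply: le_measure; rewrite ?inE //.
    exact: measurableU.
  move=> w _; have [Bw|] := boolP (0 < part (level (mu w) N) (k N))%N; [by right|].
  rewrite -eqn0Ngt => /eqP p0; left.
  rewrite /A /= mul1r natrK ltnNge leq_height // -ltnNge.
  rewrite p0 add0n /k subKn ?leq_div // truncn_gt_nat -natr1.
  have Nq : q%:R <= N%:R :> R by near: N; exact: nbhs_infty_ger.
  have h2 : (N %/ q)%:R * q%:R <= N%:R :> R by rewrite -natrM ler_nat leq_trunc_div.
  have h3 : 2 * N%:R <= xi * q%:R * N%:R by rewrite ler_wpM2r.
  have h4 : ((N %/ q)%:R + 1) * q%:R <= xi * N%:R * q%:R by lra.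
  by move: h4; rewrite ler_pM2r.
move/cvg_lim => /(_ (@ereal_hausdorff R)); rewrite lim_cst; last exact: ereal_hausdorff.
by move=> [/eqP]; rewrite oner_eq0.
Unshelve. all: by end_near. Qed.


End BottomRow.

(** * Convergence of the rescaled parts *)

Theorem theorem5p5 (R : realType) (x y beta : R)
    (x_gt0 : 0 < x) (y_gt0 : 0 < y) (beta_lt0 : beta < 0) (xy_lt1 : x * y < 1)
    (* the Grothendieck random partitions *)
    (dG : nat -> measure_display) (TG : forall N, measurableType (dG N))
    (PG : forall N, probability (TG N) R)
    (lam : forall N, TG N -> npartition N)
    (lamP : forall N, is_grothendieck x y beta (PG N) (lam N))
    (* the associated Schur processes *)
    (dS : nat -> measure_display) (TS : forall N, measurableType (dS N))
    (PS : forall N, probability (TS N) R)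
    (mu : forall N, TS N -> N.-tuple (npartition N))
    (muP : forall N, is_schur_process x y beta (PS N) (mu N))
    (* the limit shape and its diagonal section *)
    (h : R -> R -> R) (hP : is_limit_shape PS mu h)
    (L : R -> R)
    (L_ge0 : forall t, 0 <= t <= 1 -> 0 <= L t)
    (L_cont : {within `[0, 1], continuous L})
    (LP : forall t, 0 <= t <= 1 -> h (L t) t = t)
    (tau : R) (tau_in : 0 < tau <= 1) :
  cvg_in_probability PG
    (fun N w => (part (lam N w) (Num.truncn (tau * N%:R)))%:R / N%:R)
    (L tau + tau - 1).
Proof.
have [_ _ h_xi h_tau _] := hP.
have L10 : L 1 = 0.
  have t1 : (0 : R) <= 1 <= (1 : R) by rewrite ler01 lexx.
  apply/eqP; rewrite eq_le L_ge0 // andbT leNgt; apply/negP => L1.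
  have := @limit_shape_last_lt1 R x y beta x_gt0 y_gt0 xy_lt1 dS TS PS mu muP h hP (L 1) L1.
  by rewrite LP // ltxx.
have L0 : 0 <= L tau by apply: L_ge0; lra.
move=> eps eps0.
pose t N := Num.truncn (tau * N%:R).
(* Rounding down favours the upper bound, where the full [eps] can be kept. In the lower bound,
   [t N] and [am N] cost up to one unit each, and the spared eps/2 pays for them once eps N >= 4. *)
pose ap N := Num.truncn ((L tau + eps) * N%:R).
pose xim := Num.max 0 (L tau - eps / 2).
pose am N := Num.truncn (xim * N%:R).
pose pos N w := (part (lam N w) (t N) + (N - t N))%N.
have mG N := measurable_preimage_points (fun p => (lamP N p).1).
have mS N := measurable_preimage_points (measurable_process (muP N)).
have tau0 : 0 < tau by lra.
have t_bounds N : tau * N%:R - 1 < (t N)%:R <= tau * N%:R.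
  by apply: truncn_scale_bounds; lra.
have tN N : (t N <= N)%N.
  have /andP[_ h1] := t_bounds N; rewrite -(ler_nat R); apply: le_trans h1 _.
  by rewrite ler_piMl //; lra.
have near_t : \forall N \near \oo, (0 < t N <= N)%N.
  near=> N; rewrite tN andbT -(ltr_nat R); have /andP[+ _] := t_bounds N.
  have : 1 <= tau * N%:R by near: N; exact: near_natr_mul_ge.
  by lra.
have upper : (fun N => PG N [set w | (ap N <= pos N w)%N]) @ \oo --> 0%E.
  have hlt : h (L tau + eps) tau < tau.
    by apply: (height_above_section h_xi h_tau L_ge0 L_cont LP) => //; lra.
  pose c := (h (L tau + eps) tau + tau) / 2.
  have hc : h (L tau + eps) tau < c by rewrite /c; lra.
  have kc : \forall N \near \oo, c * N%:R <= (t N)%:R.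
    near=> N; have /andP[+ _] := t_bounds N.
    have : 1 <= (tau - c) * N%:R.
      by near: N; apply: near_natr_mul_ge; rewrite /c; lra.
    by lra.
  have xi0 : 0 <= L tau + eps by lra.
  apply: cvge0_le (height_ge_cvg0 muP hP xi0 tau_in hc kc).
  near=> N; rewrite measure_ge0 /=.
  have tN1 : (0 < t N <= N)%N by near: N.
  have N0 : (0 < N)%N by have /andP[t0 tle] := tN1; exact: leq_trans t0 tle.
  by rewrite (grothendieck_height_law N0 (muP N) xy_lt1 x_gt0 beta_lt0 (lamP N)).
have lower : (fun N => PG N [set w | (pos N w < am N)%N]) @ \oo --> 0%E.
  (* If [L tau - eps / 2] is not positive, [am N] is 0 and the event is empty. The case tau = 1
     always falls here, because L 1 = 0. *)
  have [xim0|xim_gt0] := leP (L tau - eps / 2) 0.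
    have -> : (fun N => PG N [set w | (pos N w < am N)%N]) = (fun=> 0%E).
      apply/funext => N; rewrite -(measure0 (PG N)); congr (PG N _).
      by rewrite /am /xim max_l // mul0r truncn0; apply/seteqP; split.
    exact: cvg_cst.
  have ximE : xim = L tau - eps / 2 by rewrite /xim max_r // ltW.
  have tau1 : 0 < tau < 1.
    rewrite tau0 lt_neqAle; have [tauE|_] := eqVneq tau 1; last by lra.
    by move: xim_gt0; rewrite tauE L10; lra.
  have hgt : tau < h xim tau.
    by apply: (height_below_section h_xi h_tau L_cont LP) => //; rewrite ximE; lra.
  have xi0 : 0 <= xim by rewrite ximE; lra.
  have kc : \forall N \near \oo, (t N)%:R <= tau * N%:R.
    by near=> N; have /andP[] := t_bounds N.
  apply: cvge0_le (height_lt_cvg0 muP hP xi0 tau_in hgt kc).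
  near=> N; rewrite measure_ge0 /=.
  have tN1 : (0 < t N <= N)%N by near: N.
  have N0 : (0 < N)%N by have /andP[t0 tle] := tN1; exact: leq_trans t0 tle.
  have lawE := grothendieck_height_law N0 (muP N) xy_lt1 x_gt0 beta_lt0 (lamP N) (am N) tN1.
  have -> : [set w | (pos N w < am N)%N] = ~` [set w | (am N <= pos N w)%N].
    by apply/seteqP; split => w /=; rewrite ltnNge => /negP.
  have -> : [set w | (height (mu N w) (am N) (t N) < t N)%N] =
      ~` [set w | (t N <= height (mu N w) (am N) (t N))%N].
    by apply/seteqP; split => w /=; rewrite ltnNge => /negP.
  rewrite probability_setC; last first.
    exact: (mG N [set p | (am N <= part p (t N) + (N - t N))%N]).
  rewrite probability_setC; last first.
    exact: (mS N [set m | (t N <= height m (am N) (t N))%N]).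
  by rewrite lawE.
have := cvgeD (isT : ((0 : \bar R) +? (0 : \bar R))%E) upper lower.
rewrite adde0 => both; apply: (cvge0_le _ (both _)); near=> N.
rewrite measure_ge0 /=.
have mA : measurable [set w | (ap N <= pos N w)%N].
  exact: (mG N [set p | (ap N <= part p (t N) + (N - t N))%N]).
have mB : measurable [set w | (pos N w < am N)%N].
  exact: (mG N [set p | (part p (t N) + (N - t N) < am N)%N]).
apply: le_trans (measureU2 _ mA mB); apply: le_measure; rewrite ?inE.
- exact: (mG N [set p | eps <= `|(part p (t N))%:R / N%:R - (L tau + tau - 1)|]).
- exact: measurableU.
have N0 : 0 < N%:R :> R by rewrite ltr0n; near: N; exact: nbhs_infty_gt.
have epsN : 4 <= eps * N%:R by near: N; exact: near_natr_mul_ge.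
have /andP[t1 t2] := t_bounds N.
have posE w : (pos N w)%:R = (part (lam N w) (t N))%:R + (N%:R - (t N)%:R) :> R.
  by rewrite /pos natrD natrB.
move=> w /=; rewrite ler_normr => /orP[].
  rewrite lerBrDr ler_pdivlMr // => hw; left.
  have /andP[_ a2] : _ := truncn_scale_bounds N (ltac:(lra) : 0 <= L tau + eps).
  by rewrite -(ler_nat R) posE; rewrite -/(ap N) in a2; lra.
rewrite opprB lerBrDr -lerBrDl ler_pdivrMr // => hw; right.
have xim0 : 0 <= xim by rewrite /xim le_max lexx.
have ximL : L tau - eps / 2 <= xim by rewrite /xim le_max lexx orbT.
have /andP[a1 _] := truncn_scale_bounds N xim0; rewrite -/(am N) in a1.
rewrite -(ltr_nat R) posE.
have : (L tau - eps / 2) * N%:R <= xim * N%:R by rewrite ler_pM2r.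
by lra.
Unshelve. all: by end_near. Qed.
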